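(* Let $\#$ be a new symbol of rank 1, and for a tree language $L$ let $\#(L)=\{\#(t)\mid t\in L\}$. Then \[\text{MC-TAL}=\{L\in\mathrm{MCFT}\mid L\text{ is root consistent}\}\qquad\text{and}\qquad\mathrm{MCFT}=\{L\mid\#(L)\in\text{MC-TAL}\}.\]
   Context: **Sequences and trees.** $\mathbb N_0$ is the set of nonnegative integers, $[n]=\{1,\dots,n\}$. $A^*$ (resp. $A^+$) is the set of finite (resp. nonempty finite) sequences over $A$; a sequence of length 1 is identified with its element; juxtaposition is concatenation; $\mathrm{occ}(w)$ is the set of elements occurring in the sequence $w$; $w$ is repetition-free if no element occurs twice in it. A ranked alphabet is a set $\Sigma$ with a rank map $\mathrm{rk}\colon\Sigma\to\mathbb N_0$ (applied elementwise to sequences); $\Sigma^{(k)}$ is the set of symbols of rank $k$. $T_\Sigma$ is the set of trees over $\Sigma$: the smallest set of strings over $\Sigma$ containing $\sigma t_1\cdots t_k$ (also written $\sigma(t_1,\dots,t_k)$) for all $\sigma\in\Sigma^{(k)}$ and $t_i\in T_\Sigma$. A tree language is a set of trees over a finite ranked alphabet (here: not containing the new symbol $\#$ where $\#(L)$ is formed). A forest is a finite sequence of trees. $X=\{x_1,x_2,\dots\}$ is a set of variables (of rank 0, disjoint from other alphabets), $X_k=\{x_1,\dots,x_k\}$. A pattern of rank $k$ over $\Sigma$ is a tree over $\Sigma\cup X_k$ in which each of $x_1,\dots,x_k$ occurs exactly once; $P_\Sigma(X_k)$ is the set of these and $P_\Sigma(X)=\bigcup_k P_\Sigma(X_k)$.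 For a forest $t$, $\mathrm{occ}_\Omega(t)$ is the set of symbols of $\Omega$ occurring in $t$; $t$ is uniquely $\Omega$-labeled if each symbol of $\Omega$ occurs at most once in $t$. **Substitution.** For a repetition-free sequence of symbols $\sigma=(\sigma_1,\dots,\sigma_n)$ and patterns $u=(u_1,\dots,u_n)$ with $\mathrm{rk}(u)=\mathrm{rk}(\sigma)$, $t[\sigma\gets u]$ is obtained from $t$ by replacing, recursively, each subtree $\sigma_i(s_1,\dots,s_k)$ by $u_i$ in which $x_j$ is replaced by the transformed $s_j$ (componentwise on forests). For $\mathcal L=\{B_1,\dots,B_k\}$ with $B_1\cdots B_k$ repetition-free and forests $f(B_i)$ with $\mathrm{rk}(f(B_i))=\mathrm{rk}(B_i)$, $t[B\gets f(B)\mid B\in\mathcal L]$ means $t[B_1\cdots B_k\gets f(B_1)\cdots f(B_k)]$. **MCFTG.** A multiple context-free tree grammar (MCFTG) is $G=(N,\mathcal N,\Sigma,S,R)$ where $N$ is a finite ranked alphabet of nonterminals; $\mathcal N\subseteq N^+$ is a finite set of repetition-free sequences (big nonterminals) with $\mathrm{occ}(A)\ne\mathrm{occ}(A')$ for distinct $A,A'\in\mathcal N$; $\Sigma$ is a finite ranked alphabet of terminals, disjoint from $N$, containing a symbol of rank at least 1; $S\in\mathcal N\cap N^{(0)}$ is the initial nonterminal; $R$ is a finite set of rules $A\to(u,\mathcal L)$ with $A\in\mathcal N$, $u\in P_{N\cup\Sigma}(X)^+$ a uniquely $N$-labeled forest with $\mathrm{rk}(u)=\mathrm{rk}(A)$,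 and $\mathcal L\subseteq\mathcal N$ (the links) such that the sets $\mathrm{occ}(B)$, $B\in\mathcal L$, are pairwise disjoint with union $\mathrm{occ}_N(u)$. The sets $L(G,A)$, $A\in\mathcal N$, are simultaneously the smallest sets of forests such that for every rule $A\to(u,\mathcal L)$ and all $f(B)\in L(G,B)$ ($B\in\mathcal L$), $u[B\gets f(B)\mid B\in\mathcal L]\in L(G,A)$. $L(G)=L(G,S)\subseteq T_\Sigma$. $\mathrm{MCFT}$ is the class of tree languages generated by MCFTGs. **MC-TAG.** A pattern $t\in P_{N\cup\Sigma}(X_k)$ is footed if either $k=0$, or $k\ge1$ and $t$ has a node (the foot node) labeled by a symbol of $N\cup\Sigma$ of rank $k$ whose $i$-th child is labeled $x_i$ for every $i\in[k]$. An MCFTG is footed if for each rule $A\to((u_1,\dots,u_n),\mathcal L)$ all $u_j$ are footed. An MC-TAG (strict set-local multi-component tree adjoining grammar) is a footed MCFTG for which there is an equivalence relation $\equiv$ on $N\cup\Sigma$ such that (1) for all $\sigma,\tau\in\Sigma$, if $\sigma\ne\tau$ and $\sigma\equiv\tau$ then $\mathrm{rk}(\sigma)\ne\mathrm{rk}(\tau)$; (2) for every $C\in N$ there is $\sigma\in\Sigma$ with $C\equiv\sigma$; (3) for every rule $(A_1,\dots,A_n)\to((u_1,\dots,u_n),\mathcal L)$ and $j\in[n]$, the root label of $u_j$ is $\equiv A_j$, and if $\mathrm{rk}(A_j)\ge1$ then the label of the foot node of $u_j$ is $\equiv A_j$. MC-TAL is the class of tree languages generated by MC-TAGs. A tree language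 $L$ is root consistent if any two trees in $L$ with different root labels have root labels of different ranks. *)

(* Defs.v *)
From HB Require Import structures.
From mathcomp Require Import all_boot finmap.
From mathcomp Require Import classical_sets.

Set Implicit Arguments.
Unset Strict Implicit.
Unset Printing Implicit Defensive.

(* [Var i] is the variable x_(i+1): variables are numbered from 0. *)
Inductive tree (S : Type) : Type :=
| Var of nat
| Node of S & seq (tree S).

Arguments Var {S} i.

Section TreeChoice.
Variable S : Type.

Fixpoint tree_encode (t : tree S) : GenTree.tree (nat + S) :=
  match t with
  | Var i => GenTree.Leaf (inl i)
  | Node a ts => GenTree.Node 0 (GenTree.Leaf (inr a) :: map tree_encode ts)
  end.

Fixpoint tree_decode (t : GenTree.tree (nat + S)) : option (tree S) :=
  match t with
  | GenTree.Leaf (inl i) => Some (Var i)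
  | GenTree.Node _ (GenTree.Leaf (inr a) :: ts) =>
      Some (Node a (pmap tree_decode ts))
  | _ => None
  end.

Fixpoint tree_encodeK (t : tree S) : tree_decode (tree_encode t) = Some t.
Proof.
case: t => [i | a ts] //=.
suff -> : pmap tree_decode (map tree_encode ts) = ts by [].
by elim: ts => [|t ts IHts] //=; rewrite tree_encodeK /= IHts.
Qed.

End TreeChoice.

HB.instance Definition _ (S : eqType) :=
  Equality.copy (tree S) (pcan_type (@tree_encodeK S)).
HB.instance Definition _ (S : choiceType) :=
  Choice.copy (tree S) (pcan_type (@tree_encodeK S)).

Section Trees.
Variable S : Type.
Implicit Types (t : tree S) (rk : S -> nat) (P : pred S).

Fixpoint labels t : seq S :=
  if t is Node a ts then a :: flatten (map labels ts) else [::].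

Fixpoint vars t : seq nat :=
  match t with
  | Var i => [:: i]
  | Node _ ts => flatten (map vars ts)
  end.

Fixpoint subtrees t : seq (tree S) :=
  if t is Node a ts then t :: flatten (map subtrees ts) else [:: t].

Definition root_label t : option S := if t is Node a _ then Some a else None.

(* Trees over the ranked alphabet [P], in which variables (of rank 0) may
   also occur. *)
Fixpoint wf rk P t : bool :=
  if t is Node a ts then [&& P a, size ts == rk a & all (wf rk P) ts] else true.

Definition is_tree rk P t : bool := wf rk P t && nilp (vars t).

(* The variables of a pattern of rank [k] are x_1, ..., x_k, once each. *)
Definition is_pattern rk P (k : nat) t : bool :=
  wf rk P t && perm_eq (vars t) (iota 0 k).

(* First-order substitution of the i-th tree of [s] for x_i. *)
Fixpoint vsubst (s : seq (tree S)) t : tree S :=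
  match t with
  | Var i => nth (Var i) s i
  | Node a ts => Node a (map (vsubst s) ts)
  end.

End Trees.

Fixpoint relabel (S S' : Type) (h : S -> S') (t : tree S) : tree S' :=
  match t with
  | Var i => Var i
  | Node a ts => Node (h a) (map (relabel h) ts)
  end.

(* Second-order substitution t[sigma <- u], for sigma repetition-free. *)
Fixpoint subst (S : eqType) (sigma : seq S) (u : seq (tree S)) (t : tree S)
    : tree S :=
  match t with
  | Var i => Var i
  | Node a ts =>
      let ts' := map (subst sigma u) ts in
      if a \in sigma then vsubst ts' (nth (Var 0) u (index a sigma))
      else Node a ts'
  end.

(* [foot_label k a t]: the tree t has a node with label a and children
   x_1, ..., x_k; in a well-formed tree, a then has rank k. *)
Definition foot_label (S : eqType) (k : nat) (a : S) (t : tree S) : bool :=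
  Node a (mkseq Var k) \in subtrees t.

Definition footed (S : eqType) (k : nat) (t : tree S) : Prop :=
  k = 0 \/ (0 < k /\ exists a, foot_label k a t).

Record rule (N : finType) (U : choiceType) : Type := Rule {
  lhs : seq N;
  rhs : seq (tree (N + U));
  links : {fset seq N}
}.

Section RuleChoice.
Variables (N : finType) (U : choiceType).

Definition rule_encode (r : rule N U) := (lhs r, rhs r, links r).
Definition rule_decode (p : seq N * seq (tree (N + U)) * {fset seq N}) :=
  Rule p.1.1 p.1.2 p.2.
Lemma rule_encodeK : cancel rule_encode rule_decode.
Proof. by case. Qed.

HB.instance Definition _ := Choice.copy (rule N U) (can_type rule_encodeK).

End RuleChoice.

(* Terminals are taken from a fixed, possibly infinite, ranked set [U] of
   symbols. The nonterminals are the elements of [N]; labelling trees by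
   [N + U] makes them disjoint from the terminals. *)
Record grammar (N : finType) (U : choiceType) : Type := Grammar {
  nrk : N -> nat;
  bigs : {fset seq N};
  terms : {fset U};
  start : N;
  rules : {fset rule N U}
}.

Section MCFTG.
Variables (N : finType) (U : choiceType) (rk : U -> nat) (G : grammar N U).

Definition sym_rk (a : N + U) : nat :=
  match a with inl C => nrk G C | inr s => rk s end.

(* The alphabet N :|: Sigma. *)
Definition gsym : pred (N + U) :=
  fun a => if a is inr s then s \in terms G else true.

Definition nonterms (u : seq (tree (N + U))) : seq N :=
  pmap (fun a => if a is inl C then Some C else None) (flatten (map (@labels _) u)).

Definition valid_rule (r : rule N U) : Prop :=
  [/\ lhs r \in bigs G,
      all2 (fun A t => is_pattern sym_rk gsym (nrk G A) t) (lhs r) (rhs r),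
      uniq (nonterms (rhs r)),
      (links r `<=` bigs G)%fset &
      {in links r &, forall B B' : seq N, B != B' -> [disjoint B & B']} /\
      (forall C, C \in nonterms (rhs r) <-> exists2 B, B \in links r & C \in B)].

Definition is_mcftg : Prop :=
  [/\ {in bigs G, forall A, A != [::] /\ uniq A},
      {in bigs G &, forall A A', A =i A' -> A = A'},
      exists2 s, s \in terms G & 0 < rk s,
      [:: start G] \in bigs G /\ nrk G (start G) = 0 &
      {in rules G, forall r, valid_rule r}].

(* u[B <- f(B) | B in Ls]; the order in which Ls is enumerated is immaterial,
   its elements being pairwise disjoint. *)
Definition link_subst (Ls : {fset seq N}) (f : seq N -> seq (tree (N + U)))
    (u : seq (tree (N + U))) : seq (tree (N + U)) :=
  map (subst (map inl (flatten Ls)) (flatten (map f Ls))) u.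

(* [gen A t]: t is in L(G, A). *)
Inductive gen : seq N -> seq (tree (N + U)) -> Prop :=
| gen_rule r f : r \in rules G ->
    (forall B, B \in links r -> gen B (f B)) ->
    gen (lhs r) (link_subst (links r) f (rhs r)).

Definition lang : set (tree U) :=
  [set t | gen [:: start G] [:: relabel inr t]]%classic.

Definition footed_mcftg : Prop :=
  {in rules G, forall r A t, (A, t) \in zip (lhs r) (rhs r) ->
    footed (nrk G A) t}.

Definition is_mctag : Prop :=
  [/\ is_mcftg, footed_mcftg &
   exists e : rel (N + U),
   [/\ {in gsym & &, equivalence_rel e},
       {in terms G &, forall s s',
         s <> s' -> e (inr s) (inr s') -> rk s <> rk s'},
       forall C : N, exists2 s, s \in terms G & e (inl C) (inr s) &
       {in rules G, forall r A t, (A, t) \in zip (lhs r) (rhs r) ->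
         (exists2 a, root_label t = Some a & e a (inl A)) /\
         (0 < nrk G A ->
           exists2 a, foot_label (nrk G A) a t & e a (inl A))}]].

End MCFTG.

Local Open Scope classical_set_scope.

Section Classes.
Variables (U : choiceType) (rk : U -> nat).

Definition MCFT : set (set (tree U)) :=
  [set L | exists (N : finType) (G : grammar N U), is_mcftg rk G /\ lang G = L].

Definition MC_TAL : set (set (tree U)) :=
  [set L | exists (N : finType) (G : grammar N U), is_mctag rk G /\ lang G = L].

Definition trees_over (Sigma : {fset U}) : set (tree U) :=
  [set t | is_tree rk (mem Sigma) t].

Definition root_consistent (L : set (tree U)) : Prop :=
  forall t t' a a', L t -> L t' ->
    root_label t = Some a -> root_label t' = Some a' -> a <> a' -> rk a <> rk a'.

Definition prepend (h : U) (L : set (tree U)) : set (tree U) :=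
  [set Node h [:: t] | t in L].

End Classes.

(* Main.v *)
(** In an MC-TAG the roots of all derived trees are equivalent to the initial
nonterminal, whence root consistency. Conversely, given an MCFTG G with a root
consistent language L, let the class of a terminal be the terminal itself,
except that all root labels of trees in L form one class. Every derived
pattern is cut into pieces that are footed and whose root and foot have the
same class. This is done bottom-up: a node is at first a piece of its own, and
is then merged with everything down to a piece of the same class that lies
above all of its variables, if there is one; ground subtrees are not cut. The
tree of pieces, of which only the class and the rank
are remembered, is the skeleton of the pattern. On a path of a skeleton no class
occurs twice above the same number of variables, so there are finitely many
skeletons. The MC-TAG guesses a skeleton for every nonterminal of G and has one
nonterminal for every node of these skeletons; its rules are obtained by
substituting the skeletons in a right-hand side of G and cutting the result
into pieces again. No canonicity is needed: the annotations computed bottom-up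
along a derivation merely have to flatten to the forests derived by G.

For the second equality, #(L) is trivially root consistent, a # is put on top
by a new initial rule, and it is removed again by erasing it in all rules. *)

Require Import Defs.
From mathcomp Require Import all_boot finmap.
From mathcomp Require Import classical_sets.
From mathcomp Require Import boolp zify.

Set Implicit Arguments.
Unset Strict Implicit.
Unset Printing Implicit Defensive.

(** * Trees and substitution *)

(** The generated principle gives no hypothesis for the trees inside the list of children, so the
    principle is built with a nested induction on that list. *)
Lemma tree_ind_in (S : eqType) (P : tree S -> Prop) :
  (forall i, P (Var i)) ->
  (forall a ts, {in ts, forall t, P t} -> P (Node a ts)) -> forall t, P t.
Proof.
move=> hV hN; fix IH 1 => -[i|a ts]; first exact: hV.
apply: hN; elim: ts => [u|t ts IHts u]; first (rewrite in_nil; discriminate).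
rewrite inE => /predU1P[->|/IHts]; [exact: IH|exact].
Qed.

Section TreeLemmas.
Variable S : eqType.
Implicit Types (t u : tree S) (s ts : seq (tree S)).

Lemma nthV_map (T T' : Type) (f : tree T -> tree T') (ss : seq (tree T)) i :
  f (Var i) = Var i -> nth (Var i) (map f ss) i = f (nth (Var i) ss i).
Proof.
move=> fV; case: (ltnP i (size ss)) => h; first by rewrite (nth_map (Var i)).
by rewrite !nth_default ?size_map // fV.
Qed.

Lemma map_nthV s : map (fun i => nth (Var i) s i) (iota 0 (size s)) = s.
Proof.
apply: (@eq_from_nth _ (Var 0)); rewrite size_map size_iota // => i hi.
rewrite (nth_map 0) ?size_iota // nth_iota // add0n; exact: set_nth_default.
Qed.

Lemma vsubst_nil t : vsubst [::] t = t.
Proof.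
elim/tree_ind_in: t => [i|a ts IH] /=; first by rewrite nth_nil.
by congr Node; rewrite -[RHS]map_id; apply/eq_in_map.
Qed.

Lemma vsubst_ground s t : vars t = [::] -> vsubst s t = t.
Proof.
elim/tree_ind_in: t => [i|a ts IH] //= h.
congr Node; rewrite -[RHS]map_id; apply/eq_in_map => t tts; apply: IH => //.
apply/eqP/negPn/negP => /eqP; case E: (vars t) => [//|i l] _.
have: i \in flatten (map (@vars S) ts).
  by apply/flattenP; exists (vars t); rewrite ?map_f // E inE eqxx.
by rewrite h.
Qed.

(** The bound on the variables is essential: an index beyond [size s'] survives the inner
    substitution and would be caught by the outer one. *)
Lemma vsubst_vsubst s s' t : {in vars t, forall i, i < size s'} ->
  vsubst s (vsubst s' t) = vsubst (map (vsubst s) s') t.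
Proof.
elim/tree_ind_in: t => [i|a ts IH] /= h.
  by rewrite (nth_map (Var i)) // h ?inE.
congr Node; rewrite -map_comp; apply/eq_in_map => t tts; apply: IH => // i it.
by apply: h; apply/flattenP; exists (vars t); rewrite ?map_f.
Qed.

Lemma vars_vsubst s t :
  vars (vsubst s t) = flatten [seq vars (nth (Var i) s i) | i <- vars t].
Proof.
elim/tree_ind_in: t => [i|a ts IH] /=; first by rewrite cats0.
elim: ts IH => [//|t ts IHts] IH /=.
rewrite map_cat flatten_cat IH ?inE ?eqxx // IHts // => u uts.
by apply: IH; rewrite inE uts orbT.
Qed.

Lemma labels_vsubst s t : perm_eq (labels (vsubst s t))
  (labels t ++ flatten [seq labels (nth (Var i) s i) | i <- vars t]).
Proof.
elim/tree_ind_in: t => [i|a ts IH] /=; first by rewrite cats0.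
rewrite perm_cons.
elim: ts IH => [//|t ts IHts] IH /=.
rewrite map_cat flatten_cat.
apply: (@perm_trans _ ((labels t ++ flatten [seq labels (nth (Var i) s i) | i <- vars t]) ++
   (flatten (map (@labels S) ts) ++
    flatten [seq labels (nth (Var i) s i) | i <- flatten (map (@vars S) ts)]))).
  apply: perm_cat; first by apply: IH; rewrite inE eqxx.
  by apply: IHts => u uts; apply: IH; rewrite inE uts orbT.
by rewrite -!catA perm_cat2l perm_catCA.
Qed.

Lemma wf_vsubst rk (P : pred S) s t :
  wf rk P t -> all (wf rk P) s -> wf rk P (vsubst s t).
Proof.
move=> h /allP hs; elim/tree_ind_in: t h => [i _|a ts IH] /=.
  case: (ltnP i (size s)) => hi; first by apply/hs/mem_nth.
  by rewrite nth_default.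
case/and3P=> -> hs' /allP hts; rewrite size_map hs' /= all_map.
by apply/allP => t tts /=; apply: IH => //; apply: hts.
Qed.

Lemma root_vsubst s t a : root_label t = Some a -> root_label (vsubst s t) = Some a.
Proof. by case: t. Qed.

Lemma subtrees_vsubst s t i : i \in vars t ->
  {subset subtrees (nth (Var i) s i) <= subtrees (vsubst s t)}.
Proof.
elim/tree_ind_in: t => [j|a ts IH] /=; first by rewrite inE => /eqP ->.
case/flattenP => _ /mapP[t tts ->] it x hx.
rewrite inE; apply/orP; right; apply/flattenP; exists (subtrees (vsubst s t)).
  by rewrite -map_comp; apply: (map_f (@subtrees S \o vsubst s)).
exact: IH hx.
Qed.

Lemma pattern_vars_lt rk (P : pred S) k t : is_pattern rk P k t ->
  {in vars t, forall i, i < k}.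
Proof. by case/andP => _ /perm_mem h i; rewrite h mem_iota. Qed.

Lemma flatten_nthV (T : eqType) (F : tree S -> seq T) s (p : tree S) :
  perm_eq (vars p) (iota 0 (size s)) ->
  perm_eq (flatten [seq F (nth (Var i) s i) | i <- vars p]) (flatten (map F s)).
Proof.
move=> h; rewrite -{2}(map_nthV s) -map_comp.
by apply: perm_flatten; apply: perm_map.
Qed.

Lemma vars_vsubst_pattern s p : perm_eq (vars p) (iota 0 (size s)) ->
  perm_eq (vars (vsubst s p)) (flatten (map (@vars S) s)).
Proof. by move=> h; rewrite vars_vsubst; apply: flatten_nthV. Qed.

Lemma labels_vsubst_pattern s p : perm_eq (vars p) (iota 0 (size s)) ->
  perm_eq (labels (vsubst s p)) (labels p ++ flatten (map (@labels S) s)).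
Proof.
move=> h; apply: (perm_trans (labels_vsubst _ _)).
by rewrite perm_cat2l; apply: flatten_nthV.
Qed.

Lemma vars_mkseqV k : flatten (map (@vars S) (mkseq Var k)) = iota 0 k.
Proof. by rewrite /mkseq -map_comp; elim: (iota 0 k) => //= i l ->. Qed.

Lemma vsubst_mkseqV s : map (vsubst s) (mkseq Var (size s)) = s.
Proof. by rewrite /mkseq -map_comp; apply: map_nthV. Qed.

End TreeLemmas.

(** * Relabelling *)

Section Relabel.
Variables (S T : eqType) (h : S -> T).

Lemma vars_relabel (t : tree S) : vars (relabel h t) = vars t.
Proof.
elim/tree_ind_in: t => [i|a ts IH] //=; rewrite -map_comp.
by congr flatten; apply/eq_in_map.
Qed.

Lemma labels_relabel (t : tree S) : labels (relabel h t) = map h (labels t).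
Proof.
elim/tree_ind_in: t => [i|a ts IH] //=; rewrite map_flatten -!map_comp.
by congr (_ :: flatten _); apply/eq_in_map.
Qed.

Lemma relabel_vsubst s (t : tree S) :
  relabel h (vsubst s t) = vsubst (map (relabel h) s) (relabel h t).
Proof.
elim/tree_ind_in: t => [i|a ts IH] /=; first by rewrite nthV_map.
by rewrite -!map_comp; congr Node; apply/eq_in_map.
Qed.

Lemma eq_in_relabel (h' : S -> T) t : {in labels t, h =1 h'} -> relabel h t = relabel h' t.
Proof.
elim/tree_ind_in: t => [i|a ts IH] //= e; congr Node.
  by apply: e; rewrite inE eqxx.
apply/eq_in_map => t tts; apply: IH => // x xt; apply: e.
by rewrite inE; apply/orP; right; apply/flattenP; exists (labels t); rewrite ?map_f.
Qed.

Lemma wf_relabel rk (P : pred T) t : wf rk P (relabel h t) = wf (rk \o h) (P \o h) t.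
Proof.
elim/tree_ind_in: t => [i|a ts IH] //=; rewrite size_map all_map.
by congr [&& _, _ & _]; apply: eq_in_all.
Qed.

Lemma relabel_inj : injective h -> injective (relabel h).
Proof.
move=> hi; elim/tree_ind_in => [i|a ts IH] [j|b us] //= [].
  by move=> ->.
move=> /hi -> e; congr Node; elim: ts us IH e => [|t ts IHts] [|u us] //= IH [e1 e2].
rewrite (IH t _ _ e1) ?inE ?eqxx //; congr (_ :: _); apply: IHts => // x xts.
by apply: IH; rewrite inE xts orbT.
Qed.

End Relabel.

Lemma relabel_comp (S T V : eqType) (h : S -> T) (g : T -> V) t :
  relabel g (relabel h t) = relabel (g \o h) t.
Proof.
elim/tree_ind_in: t => [i|a ts IH] //=; congr Node.
by rewrite -map_comp; apply/eq_in_map.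
Qed.

Lemma wf_labels (S : eqType) rk (P : pred S) t : wf rk P t -> all P (labels t).
Proof.
elim/tree_ind_in: t => [i|a ts IH] //= /and3P[-> _ /allP h] /=.
apply/allP => x /flattenP[_ /mapP[t tts ->]]; apply/allP; apply: IH => //; exact: h.
Qed.

Lemma eq_in_wf (S : eqType) rk rk' (P P' : pred S) t :
  {in labels t, rk =1 rk'} -> {in labels t, P =1 P'} -> wf rk P t = wf rk' P' t.
Proof.
elim/tree_ind_in: t => [i|a ts IH] //= h1 h2.
rewrite h1 ?h2 ?inE ?eqxx //; congr [&& _, _ & _].
apply: eq_in_all => t tts.
have sub : {subset labels t <= a :: flatten (map (@labels S) ts)}.
  move=> x xt; rewrite inE; apply/orP; right.
  by apply/flattenP; exists (labels t); rewrite ?map_f.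
by apply: IH => // x /sub; [apply: h1|apply: h2].
Qed.

(** * Cutting a pattern into footed pieces *)

Section Keys.
Variables (X K : eqType) (cf : X -> K).

(* A key is a class together with the number of variables below the node; in a
   reduced tree the keys on a path are distinct, which bounds its height. *)
Fixpoint keys (t : tree X) : seq (K * nat) :=
  if t is Node a ts then
    (if nilp (vars t) then [::] else [:: (cf a, size (vars t))])
      ++ flatten (map keys ts)
  else [::].

(** Ground nodes carry no key, so their depth has to be bounded separately: they must be leaves. *)
Fixpoint reduced (t : tree X) : bool :=
  if t is Node a ts then
    if nilp (vars t) then nilp ts
    else ((cf a, size (vars t)) \notin flatten (map keys ts)) && all reduced ts
  else true.

Lemma size_vars_child a ts (t : tree X) : t \in ts ->
  size (vars t) <= size (vars (Node a ts)).
Proof.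
move=> h; rewrite /= size_flatten /shape -map_comp sumnE big_map.
by rewrite (big_rem t h) leq_addr.
Qed.

Lemma keys_bound t c n : (c, n) \in keys t -> 0 < n <= size (vars t).
Proof.
elim/tree_ind_in: t => [i|a ts IH] //=.
rewrite mem_cat => /orP[|/flattenP[_ /mapP[t tts ->]] /IH].
  case: ifP => //; rewrite inE /nilp => h /eqP[_ ->]; lia.
move=> /(_ tts) /andP[-> /leq_trans]; apply; exact: (size_vars_child a tts).
Qed.

Lemma keys_class t c n : (c, n) \in keys t -> c \in map cf (labels t).
Proof.
elim/tree_ind_in: t => [i|a ts IH] //=.
rewrite mem_cat => /orP[|/flattenP[_ /mapP[t tts ->]] /IH].
  by case: ifP => //; rewrite !inE => h /eqP[-> _]; rewrite eqxx.
move=> /(_ tts) /mapP[x xt ->]; apply: (@map_f _ _ cf (a :: _)); rewrite inE; apply/orP; right.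
by apply/flattenP; exists (labels t); rewrite ?map_f.
Qed.

End Keys.

Lemma keys_relabel (X Y K : eqType) (h : X -> Y) (cf : Y -> K) t :
  keys cf (relabel h t) = keys (cf \o h) t.
Proof.
elim/tree_ind_in: t => [i|a ts IH] //.
move: (vars_relabel h (Node a ts)) => /= ->.
by congr (_ ++ flatten _); rewrite -map_comp; apply/eq_in_map.
Qed.

Lemma reduced_relabel (X Y K : eqType) (h : X -> Y) (cf : Y -> K) t :
  reduced cf (relabel h t) = reduced (cf \o h) t.
Proof.
elim/tree_ind_in: t => [i|a ts IH] //.
move: (vars_relabel h (Node a ts)) => /= ->.
rewrite /nilp size_map -map_comp all_map; congr (if _ then _ else (_ \notin flatten _) && _).
  by apply/eq_in_map => t _ /=; rewrite keys_relabel.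
by apply: eq_in_all.
Qed.

Fixpoint flat (V : Type) (d : tree (tree V)) : tree V :=
  match d with
  | Var i => Var i
  | Node p ds => vsubst (map (@flat V) ds) p
  end.

Lemma flatten_nil (T : eqType) (ss : seq (seq T)) :
  flatten ss = [::] -> {in ss, forall s, s = [::]}.
Proof.
elim: ss => [//|s ss IH] /= h x; have := congr1 size h; rewrite size_cat /= => /eqP.
rewrite addn_eq0 => /andP[/nilP e1 /nilP e2].
by rewrite inE => /orP[/eqP -> //|]; apply: IH.
Qed.

Section Decomp.
Variables (S K : eqType) (k0 : K) (rk : S -> nat) (P : pred S) (cl : S -> K).
Variable M : nat.
Hypothesis rkM : forall a, P a -> rk a <= M.

(** The default [k0] is the class of a bare variable, which is never a piece. *)
Definition info (p : tree S) : K * nat :=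
  (if p is Node a _ then cl a else k0, size (vars p)).

Definition has_foot (k : nat) (c : K) (p : tree S) : Prop :=
  exists2 a, foot_label k a p & cl a = c.

(* The conditions that an MC-TAG imposes on the right-hand sides of a rule. *)
Definition piece (p : tree S) : Prop :=
  [/\ is_pattern rk P (size (vars p)) p, size (vars p) <= M,
      root_label p <> None &
      0 < size (vars p) -> has_foot (size (vars p)) (info p).1 p].

Definition decomposition (d : tree (tree S)) : Prop :=
  wf (fun p => size (vars p)) predT d /\ {in labels d, forall p, piece p}.

Lemma decomposition_node p ds : decomposition (Node p ds) <->
  [/\ piece p, size ds = size (vars p) & {in ds, forall d, decomposition d}].
Proof.
split.
  case=> /= /andP[/eqP h1 /allP h2] h3; split => //.
    by apply: h3; rewrite inE eqxx.
  move=> d dds; split; first exact: h2.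
  move=> q qd; apply: h3; rewrite inE; apply/orP; right.
  by apply/flattenP; exists (labels d); rewrite ?map_f.
case=> h1 h2 h3; split => /=.
  by rewrite h2 eqxx /=; apply/allP => d /h3 [].
move=> q; rewrite inE => /orP[/eqP -> //|/flattenP[_ /mapP[d dds ->]]].
by case: (h3 d dds) => _; apply.
Qed.

Lemma piece_pattern p k : piece p -> k = size (vars p) ->
  perm_eq (vars p) (iota 0 k).
Proof. by case=> /andP[_ h] _ _ _ ->. Qed.

Lemma vars_flat d : decomposition d -> perm_eq (vars (flat d)) (vars d).
Proof.
elim/tree_ind_in: d => [i|p ds IH] //= /decomposition_node[h1 h2 h3].
apply: (perm_trans (vars_vsubst_pattern _)).
  by apply: piece_pattern => //; rewrite size_map.
rewrite -map_comp.
elim: ds IH h3 {h2} => [//|d ds IHds] IH h3 /=; apply: perm_cat.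
  by apply: IH; rewrite ?inE ?eqxx //; apply: h3; rewrite inE eqxx.
by apply: IHds => x xds; [apply: IH|apply: h3]; rewrite inE xds orbT.
Qed.

Lemma wf_flat d : decomposition d -> wf rk P (flat d).
Proof.
elim/tree_ind_in: d => [i|p ds IH] //= /decomposition_node[[/andP[h1 _] _ _ _] h2 h3].
apply: wf_vsubst => //; rewrite all_map; apply/allP => d dds /=.
by apply: IH => //; apply: h3.
Qed.

Lemma labels_flat d : decomposition d ->
  perm_eq (labels (flat d)) (flatten (map (@labels S) (labels d))).
Proof.
elim/tree_ind_in: d => [i|p ds IH] //= /decomposition_node[h1 h2 h3].
apply: (perm_trans (labels_vsubst_pattern _)).
  by apply: piece_pattern => //; rewrite size_map.
rewrite perm_cat2l -map_comp.
elim: ds IH h3 {h2} => [//|d ds IHds] IH h3 /=.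
rewrite map_cat flatten_cat; apply: perm_cat.
  by apply: IH; rewrite ?inE ?eqxx //; apply: h3; rewrite inE eqxx.
by apply: IHds => x xds; [apply: IH|apply: h3]; rewrite inE xds orbT.
Qed.

(* Plugging a footed pattern q into the only argument of p that contains
   variables: the result inherits the root of p and the foot of q. *)
Lemma compose p q ts1 ts2 us :
  is_pattern rk P (size (ts1 ++ vsubst us q :: ts2)) p ->
  {in ts1 ++ ts2, forall t, wf rk P t /\ vars t = [::]} ->
  is_pattern rk P (size us) q ->
  let p' := vsubst (ts1 ++ q :: ts2) p in
  [/\ vsubst us p' = vsubst (ts1 ++ vsubst us q :: ts2) p,
      is_pattern rk P (size us) p' &
      forall a, foot_label (size us) a q -> foot_label (size us) a p'].
Proof.
move=> hp hts hq p'; case/andP: (hp) => wp pp; case/andP: (hq) => wq pq.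
have ss : size (ts1 ++ vsubst us q :: ts2) = size (ts1 ++ q :: ts2).
  by rewrite !size_cat.
have g ts : {subset ts <= ts1 ++ ts2} -> map (vsubst us) ts = ts.
  move=> sub; rewrite -[RHS]map_id; apply/eq_in_map => t /sub /hts[_ vt].
  exact: vsubst_ground.
have g0 ts : {subset ts <= ts1 ++ ts2} -> flatten (map (@vars S) ts) = [::].
  elim: ts => [//|t ts IHts] sub /=; rewrite IHts ?cats0.
    by case: (hts t (sub _ _)); rewrite ?inE ?eqxx.
  by move=> x xts; apply: sub; rewrite inE xts orbT.
have s1 : {subset ts1 <= ts1 ++ ts2} by move=> x xt; rewrite mem_cat xt.
have s2 : {subset ts2 <= ts1 ++ ts2} by move=> x xt; rewrite mem_cat xt orbT.
have pp' : perm_eq (vars p) (iota 0 (size (ts1 ++ q :: ts2))) by rewrite -ss.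
split.
- rewrite /p' vsubst_vsubst.
    by rewrite map_cat /= !g.
  by move=> i; rewrite (perm_mem pp') mem_iota.
- apply/andP; split.
    apply: wf_vsubst => //; rewrite all_cat /= wq.
    by apply/and3P; split => //; apply/allP => t; [move/s1|move/s2] => /hts[].
  apply: (perm_trans (vars_vsubst_pattern pp')).
  by rewrite map_cat flatten_cat /= !g0 //= cats0.
- move=> a; rewrite /foot_label /p' => h.
  (* [q] is the argument at position [size ts1], so it sits inside [p'] as a subtree, together with
     its foot. *)
  have i1 : size ts1 \in vars p.
    by rewrite (perm_mem pp') mem_iota size_cat /=; lia.
  apply: (subtrees_vsubst i1); rewrite nth_cat ltnn subnn //.
Qed.

(** If one child accounts for all variables, nothing is left for its siblings. *)
Lemma sole_child (ds1 ds2 : seq (tree (tree S))) d :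
  size (flatten (map (@vars _) (ds1 ++ d :: ds2))) <= size (vars d) ->
  {in ds1 ++ ds2, forall e, vars e = [::]}.
Proof.
rewrite map_cat flatten_cat /= !size_cat => h.
have: flatten (map (@vars _) (ds1 ++ ds2)) = [::].
  by rewrite map_cat flatten_cat; apply/nilP; rewrite /nilp size_cat; lia.
by move/flatten_nil => h' e he; apply: h'; rewrite map_f.
Qed.

Lemma ground_flat e : decomposition e -> vars e = [::] ->
  wf rk P (flat e) /\ vars (flat e) = [::].
Proof.
move=> de ve; split; first exact: wf_flat.
by apply/nilP; rewrite /nilp (perm_size (vars_flat de)) ve.
Qed.

Definition cls p := (info p).1.

(* A tree of pieces that contains the key of its variables with class c can be
   cut again so that its topmost piece, which may have another class, ends in a
   foot of class c. *)
Lemma absorb c d : decomposition d -> reduced cls d ->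
  (c, size (vars d)) \in keys cls d ->
  exists q es, [/\ vsubst (map (@flat S) es) q = flat d,
    is_pattern rk P (size es) q, has_foot (size es) c q &
    [/\ 0 < size es <= M, {in es, forall e, decomposition e /\ reduced cls e},
       size (flatten (map (@vars _) es)) = size (vars d) &
       (c, size (vars d)) \notin flatten (map (keys cls) es)]].
Proof.
elim/tree_ind_in: d => [i|p ds IH] // dd rd.
have [h1 h2 h3] := (decomposition_node p ds).1 dd.
have [p1 p2 p3 p4] := h1.
move=> hk; have v0 : 0 < size (vars (Node p ds)) by case/andP: (keys_bound hk).
have: ~~ nilp (vars (Node p ds)) by rewrite /nilp -lt0n.
move: hk rd; rewrite [keys _ _]/= [reduced _ _]/=.
set v := flatten _ in v0 *; move=> hk rd /negbTE nv; move: hk rd; rewrite nv /=.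
rewrite inE => hk /andP[nk /allP rds].
(* If the topmost piece has class [c], its own foot is the required one and the cut is made just
   below it. Otherwise the key lies in a child [d]. *)
have [/eqP[e] | ne] := boolP ((c, size v) == (cls p, size v)).
  exists p, ds; rewrite -/v e h2; split => //.
    apply: p4; rewrite -h2; case: (ds) v0 @v {nk nv hk} => //.
  split => //.
    rewrite p2 -h2 andbT; case: (ds) v0 @v {nk nv hk} => //.
  by move=> d dds; split; [apply: h3|apply: rds].
rewrite (negbTE ne) /= in hk.
have /flattenP[_ /mapP[d dds ->] kd] := hk.
(* The key counts all the variables, so [d] has them all; its siblings are then ground and can be
   glued to [p] by [compose]. *)
have vd : size (vars d) = size v.
  apply/eqP; rewrite eqn_leq (size_vars_child p dds).
  by case/andP: (keys_bound kd).
have rd : reduced cls d by apply: rds.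
have dd' : decomposition d by apply: h3.
case: (IH d dds dd' rd); first by rewrite vd.
move=> q [es [e1 e2 e3 [e4 e5 e6 e7]]].
move: dds; rewrite /v => dds.
case/splitPr: {dds} (dds) @v v0 nv nk hk rds IH dd h2 h3 vd ne kd =>
  ds1 ds2 v v0 nv nk hk rds IH dd h2 h3 vd ne kd.
have gr : {in ds1 ++ ds2, forall e, vars e = [::]}.
  by apply: (@sole_child _ _ d); rewrite -/v vd.
have := @compose p q (map (@flat S) ds1) (map (@flat S) ds2) (map (@flat S) es).
rewrite e1 -[flat d :: _]/(map (@flat S) (d :: ds2)) -map_cat !size_map h2.
case=> //.
  move=> t; rewrite -map_cat => /mapP[e he ->]; apply: ground_flat; last exact: gr.
  by apply: h3; move: he; rewrite !mem_cat inE => /orP[] ->; rewrite ?orbT.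
move=> c1 c2 c3; exists (vsubst (map (@flat S) ds1 ++ q :: map (@flat S) ds2) p), es.
split => //.
  by case: e3 => a a1 a2; exists a => //; apply: c3.
by split => //; rewrite ?e6 -?vd.
Qed.

(** The root of a one-node pattern is also its foot, so root and foot trivially have the same
    class. *)
Lemma piece_base a (ts : seq (tree S)) : P a -> size ts = rk a -> 0 < size ts ->
  piece (Node a (mkseq Var (size ts))).
Proof.
move=> Pa sts h; have sv : size (vars (Node a (mkseq Var (size ts)))) = size ts.
  by rewrite /= vars_mkseqV size_iota.
rewrite /piece sv; split => //.
- rewrite /is_pattern /= Pa size_mkseq sts eqxx vars_mkseqV perm_refl andbT /=.
  by apply/allP => t /mapP[i _ ->].
- by rewrite sts rkM.
- move=> _; exists a => //; rewrite /foot_label /=; by rewrite inE eqxx.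
Qed.

Lemma ground_leaf t : wf rk P t -> vars t = [::] -> root_label t <> None ->
  exists d, [/\ flat d = t, decomposition d & reduced cls d].
Proof.
move=> wt vt rt; exists (Node t [::]); split => /=; first exact: vsubst_nil.
  apply/decomposition_node; rewrite /piece vt; split => //; split => //.
  by rewrite /is_pattern wt vt.
by [].
Qed.

(** The children are cut first, and the new root is their common parent. Only a key equal to that of
    the root can spoil reducedness; [absorb] then lets the root piece swallow everything down to a
    foot of its class, and its last clause says that the key does not recur below. *)
Lemma decomp_exists t : wf rk P t ->
  exists d, [/\ flat d = t, decomposition d & reduced cls d].
Proof.
elim/tree_ind_in: t => [i _|a ts IH wt]; first by exists (Var i); split.
have [/nilP g|ng] := boolP (nilp (vars (Node a ts))); first exact: ground_leaf.
have := wt; rewrite /= => /and3P[Pa /eqP sts /allP wts].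
have ts0 : 0 < size ts by case: (ts) ng.
have [ds [eds hds]] : exists ds, map (@flat S) ds = ts /\
    {in ds, forall d, decomposition d /\ reduced cls d}.
  elim: ts IH wts {wt ng sts ts0} => [|t ts IHts] IH wts; first by exists [::].
  case: IHts => [u uts|u uts|ds [e1 e2]].
  - by apply: IH; rewrite inE uts orbT.
  - by apply: wts; rewrite inE uts orbT.
  case: (IH t); rewrite ?inE ?eqxx //; first by apply: wts; rewrite inE eqxx.
  move=> d [f1 f2 f3]; exists (d :: ds); split; first by rewrite /= f1 e1.
  by move=> e; rewrite inE => /orP[/eqP ->|/e2].
have pb := piece_base Pa sts ts0.
set p := Node a _ in pb.
have sv : size (vars p) = size ts by rewrite /= vars_mkseqV size_iota.
have sds : size ds = size ts by rewrite -eds size_map.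
have fp : vsubst ts p = Node a ts by rewrite /= vsubst_mkseqV.
have dd : decomposition (Node p ds).
  by apply/decomposition_node; split => //; [rewrite sds sv|move=> d /hds[]].
have fd : flat (Node p ds) = Node a ts.
  by rewrite -fp -[in RHS]eds.
have pv := vars_flat dd; rewrite fd in pv.
have ng' : nilp (vars (Node p ds)) = false.
  by apply/negbTE; rewrite /nilp -(perm_size pv).
have [hk|hk] := boolP ((cl a, size (vars (Node p ds))) \in flatten (map (keys cls) ds)); last first.
  exists (Node p ds); split => //; rewrite [reduced _ _]/= -/(vars (Node p ds)) ng' hk /=.
  by apply/allP => d /hds[].
have /flattenP[_ /mapP[d dds ->] kd] := hk.
have vd : size (vars d) = size (vars (Node p ds)).
  apply/eqP; rewrite eqn_leq (size_vars_child p dds).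
  by case/andP: (keys_bound kd).
have [d1 d2] := hds _ dds.
case: (@absorb (cl a) d d1 d2); first by rewrite vd.
move=> q [es [e1 e2 e3 [e4 e5 e6 e7]]].
case/splitPr: dds sds hds dd fd pv ng' hk vd kd eds =>
  ds1 ds2 sds hds dd fd pv ng' hk vd kd eds.
have gr : {in ds1 ++ ds2, forall e, vars e = [::]}.
  by apply: (@sole_child _ _ d); rewrite vd.
have := @compose p q (map (@flat S) ds1) (map (@flat S) ds2) (map (@flat S) es).
rewrite e1 -[flat d :: _]/(map (@flat S) (d :: ds2)) -map_cat !size_map sds.
case=> //.
- by case: pb; rewrite sv.
- move=> t; rewrite -map_cat => /mapP[e he ->]; apply: ground_flat; last exact: gr.
  by case: (hds e) => //; move: he; rewrite !mem_cat inE => /orP[] ->; rewrite ?orbT.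
rewrite eds fp; set p' := vsubst _ p => c1 c2 c3.
have sp' : size (vars p') = size es.
  by case/andP: c2 => _ /perm_size; rewrite size_iota.
have se : size (vars (Node p' es)) = size (vars (Node p (ds1 ++ d :: ds2))).
  by rewrite -vd -e6.
(* [p'] has kept the root label [a] and has received a foot of class [cl a] from [q]. *)
exists (Node p' es); split => //.
  apply/decomposition_node; rewrite /piece sp'; split => //; last by move=> e /e5[].
  case/andP: e4 => e4 e4'; split => // _.
  by case: e3 => b b1 b2; exists b => //; apply: c3.
rewrite [reduced _ _]/= -/(vars (Node p' es)).
rewrite /nilp se -/(nilp _) ng'; apply/andP; split; first by rewrite -vd.
by apply/allP => e /e5[].
Qed.

End Decomp.

(** * Finiteness of the set of skeletons *)

Fixpoint seqs_over (T : Type) (n : nat) (xs : seq T) : seq (seq T) :=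
  if n is m.+1 then [seq x :: s | x <- xs, s <- seqs_over m xs] else [:: [::]].

Lemma mem_seqs_over (T : eqType) n (xs s : seq T) :
  size s = n -> {subset s <= xs} -> s \in seqs_over n xs.
Proof.
elim: n s => [|n IH] [|x s] //= [ss] sub.
apply: allpairs_f; first by apply: sub; rewrite inE eqxx.
by apply: IH => // y ys; apply: sub; rewrite inE ys orbT.
Qed.

Fixpoint trees_upto (L : Type) (rk : L -> nat) (labs : seq L) (k h : nat) :
    seq (tree L) :=
  map Var (iota 0 k) ++
  if h is h'.+1 then
    flatten [seq map (Node l) (seqs_over (rk l) (trees_upto rk labs k h')) | l <- labs]
  else [::].

Section Skeletons.
Variables (K : eqType) (Ks : seq K) (M : nat).

Definition skel_labels : seq (K * nat) := [seq (c, n) | c <- Ks, n <- iota 0 M.+1].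

Definition skeleton (k : nat) (s : tree (K * nat)) : bool :=
  [&& wf snd (mem skel_labels) s, perm_eq (vars s) (iota 0 k) & reduced fst s].

(** A key is a class with a number of variables at most [k], so [size Ks * k.+1] bounds the number
    of distinct keys and thereby the height. The filter makes well-formedness of the members
    immediate. *)
Definition skeletons (k : nat) : seq (tree (K * nat)) :=
  [seq s <- trees_upto snd skel_labels k (size Ks * k.+1).+1
     | wf snd (mem skel_labels) s].

(** The number of distinct keys strictly decreases from a node to a child, because in a reduced tree
    the key of the root does not recur below; hence it can serve as the height bound. *)
Lemma mem_trees_upto k n (s : tree (K * nat)) :
  wf snd (mem skel_labels) s -> {in vars s, forall i, i < k} -> reduced fst s ->
  size (undup (keys fst s)) < n -> s \in trees_upto snd skel_labels k n.
Proof.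
elim: n s => [//|n IH] [i|l ts]; rewrite mem_cat.
  by move=> _ h _ _; rewrite map_f // mem_iota h ?inE.
move=> wt vt rt st; apply/orP; right.
have := wt; rewrite /= => /and3P[lt /eqP sl /allP wts].
apply/flattenP; eexists; first by apply: map_f lt.
apply: map_f; apply: mem_seqs_over => // t tts.
have vsub : {subset vars t <= vars (Node l ts)}.
  by move=> x xt /=; apply/flattenP; exists (vars t); rewrite ?map_f.
apply: IH; first exact: wts.
- by move=> i /vsub /vt.
- by move: rt => /=; case: ifP => [_ /nilP e|_ /andP[_ /allP]]; [rewrite e in tts|apply].
move: rt st; rewrite [reduced _ _]/= [keys _ _]/=.
case: ifP => [_ /nilP e|_ /andP[nk _]]; first by rewrite e in tts.
rewrite cat1s /= (negbTE nk) /= ltnS; apply: leq_ltn_trans.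
apply: uniq_leq_size; first exact: undup_uniq.
move=> x; rewrite !mem_undup => xt.
by apply/flattenP; exists (keys fst t); rewrite ?map_f.
Qed.

Lemma mem_skeletons k kmax s : skeleton k s -> k <= kmax -> s \in skeletons kmax.
Proof.
case/and3P => ws ps rs kk; have vlt : {in vars s, forall i, i < kmax}.
  by move=> i; rewrite (perm_mem ps) mem_iota => h; lia.
rewrite mem_filter ws; apply: mem_trees_upto => //; rewrite ltnS.
rewrite -(size_iota 0 kmax.+1) -(size_allpairs pair).
apply: uniq_leq_size; first exact: undup_uniq.
move=> [c n]; rewrite mem_undup => h; apply: allpairs_f.
  have /mapP[[c' m] hl ->] := keys_class h.
  have := allP (wf_labels ws) _ hl.
  by case/allpairsP => -[c1 n1] /= [h1 _ [-> _]].
have := keys_bound h; rewrite (perm_size ps) size_iota mem_iota; lia.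
Qed.

End Skeletons.

(** * Preorder numbering of forests *)

Section Numbering.

(* The nodes of a forest are numbered in preorder, as in [labels]. *)
Fixpoint number (X : Type) (n : nat) (t : tree X) : tree nat :=
  match t with
  | Var i => Var i
  | Node _ ts =>
      Node n ((fix numbers m (us : seq (tree X)) : seq (tree nat) :=
        if us is u :: us' then number m u :: numbers (m + size (labels u)) us'
        else [::]) n.+1 ts)
  end.

Fixpoint numbers (X : Type) (n : nat) (ts : seq (tree X)) : seq (tree nat) :=
  if ts is t :: ts' then number n t :: numbers (n + size (labels t)) ts' else [::].

Lemma number_node (X : Type) n (a : X) ts :
  number n (Node a ts) = Node n (numbers n.+1 ts).
Proof. by rewrite /=; congr Node; elim: ts n.+1 => //= t ts IH m; rewrite IH. Qed.


Lemma number_relabel (X Y : eqType) (h : X -> Y) t n :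
  number n (relabel h t) = number n t.
Proof.
elim/tree_ind_in: t n => [i|a ts IH] n //; rewrite [relabel _ _]/= !number_node.
congr Node; elim: ts n.+1 IH => //= t ts IHts m IH.
rewrite IH ?inE ?eqxx // labels_relabel size_map IHts // => u uts.
by apply: IH; rewrite inE uts orbT.
Qed.

Lemma numbers_relabel (X Y : eqType) (h : X -> Y) ts n :
  numbers n (map (relabel h) ts) = numbers n ts.
Proof.
elim: ts n => //= t ts IH n; by rewrite number_relabel labels_relabel size_map IH.
Qed.

Lemma labels_number (X : eqType) (t : tree X) n :
  labels (number n t) = iota n (size (labels t)).
Proof.
elim/tree_ind_in: t n => [i|a ts IH] n //; rewrite number_node /=; congr (_ :: _).
elim: ts n.+1 IH => //= t ts IHts m IH.
rewrite IH ?inE ?eqxx // IHts ?size_cat ?iotaD // => u uts.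
by apply: IH; rewrite inE uts orbT.
Qed.

Lemma labels_numbers (X : eqType) (ts : seq (tree X)) n :
  flatten (map (@labels _) (numbers n ts)) =
  iota n (size (flatten (map (@labels _) ts))).
Proof.
elim: ts n => //= t ts IH n; by rewrite labels_number IH size_cat iotaD.
Qed.

Lemma size_numbers (X : Type) n (ts : seq (tree X)) : size (numbers n ts) = size ts.
Proof. by elim: ts n => //= t ts IH n; rewrite IH. Qed.

Lemma relabel_numbers_in (X Z : eqType) (f : nat -> Z) (g : X -> Z) (ts : seq (tree X)) n :
  {in ts, forall t m, map f (iota m (size (labels t))) = map g (labels t) ->
                    relabel f (number m t) = relabel g t} ->
  map f (iota n (size (flatten (map (@labels _) ts)))) =
    map g (flatten (map (@labels _) ts)) ->
  map (relabel f) (numbers n ts) = map (relabel g) ts.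
Proof.
elim: ts n => //= t ts IHts n IH; rewrite size_cat iotaD !map_cat => /eqP.
rewrite eqseq_cat ?size_map ?size_iota // => /andP[/eqP e1 /eqP e2].
rewrite IH ?inE ?eqxx // IHts // => u uts; apply: IH.
by rewrite inE uts orbT.
Qed.

(** Numbering keeps the shape, and a tree of given shape is determined by its labels in preorder. *)
Lemma relabel_number (X Z : eqType) (f : nat -> Z) (g : X -> Z) t n :
  map f (iota n (size (labels t))) = map g (labels t) ->
  relabel f (number n t) = relabel g t.
Proof.
elim/tree_ind_in: t n => [i|a ts IH] n //; rewrite number_node /= => -[-> e].
by congr Node; apply: relabel_numbers_in => // t tts m; apply: IH.
Qed.

Lemma relabel_numbers (X Z : eqType) (f : nat -> Z) (g : X -> Z) ts n :
  map f (iota n (size (flatten (map (@labels _) ts)))) =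
    map g (flatten (map (@labels _) ts)) ->
  map (relabel f) (numbers n ts) = map (relabel g) ts.
Proof. by apply: relabel_numbers_in => t tts m; apply: relabel_number. Qed.

End Numbering.

(** * Derivations of terminal forests *)

Lemma mem_flatten_map (X Y : eqType) (F : X -> seq Y) s x y :
  x \in s -> y \in F x -> y \in flatten (map F s).
Proof. by move=> xs yx; apply/flattenP; exists (F x); rewrite ?map_f. Qed.

Lemma flatten_flatten (X : Type) (sss : seq (seq (seq X))) :
  flatten (flatten sss) = flatten (map flatten sss).
Proof. by elim: sss => //= ss sss IH; rewrite flatten_cat IH. Qed.

Lemma perm_flatten_in (X Y : eqType) (F F' : X -> seq Y) s :
  {in s, forall x, perm_eq (F x) (F' x)} ->
  perm_eq (flatten (map F s)) (flatten (map F' s)).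
Proof.
elim: s => [//|x s IH] h /=; apply: perm_cat; first by apply: h; rewrite inE eqxx.
by apply: IH => y ys; apply: h; rewrite inE ys orbT.
Qed.

Lemma uniq_flatten_map (X Y : eqType) (F : X -> seq Y) (s : seq X) :
  uniq s -> {in s, forall x, uniq (F x)} ->
  {in s &, forall x x', forall y, y \in F x -> y \in F x' -> x = x'} ->
  uniq (flatten (map F s)).
Proof.
elim: s => [//|x s IH] /= /andP[xs us] uF inj.
rewrite cat_uniq uF ?inE ?eqxx //= IH //.
- rewrite andbT; apply/hasPn => y /flattenP[_ /mapP[x' xs' ->] yx']; apply/negP => yx.
  have e : x = x' by apply: (inj _ _ _ _ y yx yx'); rewrite inE ?eqxx // xs' orbT.
  by rewrite e xs' in xs.
- by move=> z zs; apply: uF; rewrite inE zs orbT.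
- by move=> z z' zs zs'; apply: inj; rewrite inE ?zs ?zs' orbT.
Qed.

(** A second-order tree homomorphism. Compared with [subst], the substituted symbols form a separate
    summand of the alphabet and the images are given by a total function. It is used with [g] the
    identity, to evaluate, and with [inr], to expand nonterminals into skeletons. *)
Fixpoint hom (N V W : Type) (g : V -> W) (theta : N -> tree W) (t : tree (N + V))
    : tree W :=
  match t with
  | Var i => Var i
  | Node (inl C) ts => vsubst (map (hom g theta) ts) (theta C)
  | Node (inr s) ts => Node (g s) (map (hom g theta) ts)
  end.

Notation ev := (hom id).

Section Hom.
Variables (N V W : eqType) (g : V -> W).
Implicit Types (theta : N -> tree W) (t : tree (N + V)).

Lemma eq_in_hom theta theta' t : (forall C, inl C \in labels t -> theta C = theta' C) ->
  hom g theta t = hom g theta' t.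
Proof.
elim/tree_ind_in: t => [i|a ts IH] //= h.
have e : map (hom g theta) ts = map (hom g theta') ts.
  apply/eq_in_map => t tts; apply: IH => // C Ct; apply: h.
  by rewrite inE (mem_flatten_map tts Ct) orbT.
by case: a h => [C|s] h; rewrite e // h ?inE ?eqxx.
Qed.

Lemma hom_relabel_inl (X : eqType) theta (h : X -> N) (t : tree X) :
  hom g theta (relabel (fun x => inl (h x)) t) = flat (relabel (theta \o h) t).
Proof.
elim/tree_ind_in: t => [i|a ts IH] //=; rewrite -!map_comp.
by congr vsubst; apply/eq_in_map.
Qed.

Variables (rk : N + V -> nat) (P : pred (N + V)).

Lemma hom_vsubst theta s t : wf rk P t ->
  (forall C, inl C \in labels t -> {in vars (theta C), forall i, i < rk (inl C)}) ->
  hom g theta (vsubst s t) = vsubst (map (hom g theta) s) (hom g theta t).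
Proof.
elim/tree_ind_in: t => [i _ _|a ts IH] /=; first by rewrite nthV_map.
case/and3P=> _ /eqP sts /allP wts h.
have e : map (hom g theta) (map (vsubst s) ts) =
         map (vsubst (map (hom g theta) s)) (map (hom g theta) ts).
  rewrite -!map_comp; apply/eq_in_map => t tts; apply: IH => //; first exact: wts.
  by move=> C Ct; apply: h; rewrite inE (mem_flatten_map tts Ct) orbT.
case: a sts h => [C|x] sts h; rewrite e //.
by rewrite vsubst_vsubst // size_map sts; apply: h; rewrite inE eqxx.
Qed.

Lemma hom_pattern (rk' : W -> nat) (P' : pred W) k theta t : is_pattern rk P k t ->
  (forall C, inl C \in labels t -> is_pattern rk' P' (rk (inl C)) (theta C)) ->
  (forall s, inr s \in labels t -> P (inr s) -> P' (g s) /\ rk' (g s) = rk (inr s)) ->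
  is_pattern rk' P' k (hom g theta t).
Proof.
move=> /andP[wt vt] h1 h2.
suff [w p] : wf rk' P' (hom g theta t) /\ perm_eq (vars (hom g theta t)) (vars t).
  by rewrite /is_pattern w (perm_trans p vt).
elim/tree_ind_in: t {vt} wt h1 h2 => [i|a ts IH] //= /and3P[Pa /eqP sts /allP wts] h1 h2.
have {}IH t : t \in ts -> wf rk' P' (hom g theta t) /\ perm_eq (vars (hom g theta t)) (vars t).
  move=> tts; apply: IH => // [|x xt|x xt].
  - exact: wts.
  - by apply: h1; rewrite inE (mem_flatten_map tts xt) orbT.
  - by apply: h2; rewrite inE (mem_flatten_map tts xt) orbT.
have pv : perm_eq (flatten (map (@vars W) (map (hom g theta) ts))) (flatten (map (@vars _) ts)).
  rewrite -map_comp; apply: perm_flatten_in => t /IH[] //.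
have aw : all (wf rk' P') (map (hom g theta) ts).
  by rewrite all_map; apply/allP => t /IH[].
case: a Pa sts h1 h2 => [C|s] Pa sts h1 h2; last first.
  by case: (h2 s) => //= [|-> ->]; rewrite ?inE ?eqxx // size_map sts eqxx.
have /andP[c1 c2] : is_pattern rk' P' (rk (inl C)) (theta C).
  by apply: h1; rewrite inE eqxx.
split; first exact: wf_vsubst.
by apply: perm_trans pv; apply: vars_vsubst_pattern; rewrite size_map sts.
Qed.

(** Each image uses each of its variables exactly once, so subtrees are neither deleted nor copied;
    only the order of the labels may change. *)
Lemma labels_hom theta t : wf rk P t ->
  (forall C, inl C \in labels t -> perm_eq (vars (theta C)) (iota 0 (rk (inl C)))) ->
  perm_eq (labels (hom g theta t))
    (flatten [seq match a with inl C => labels (theta C) | inr s => [:: g s] end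
       | a <- labels t]).
Proof.
elim/tree_ind_in: t => [i|a ts IH] //= /and3P[Pa /eqP sts /allP wts] h1.
have pl : perm_eq (flatten (map (@labels W) (map (hom g theta) ts)))
    (flatten [seq match a with inl C => labels (theta C) | inr s => [:: g s] end
       | a <- flatten (map (@labels _) ts)]).
  rewrite map_flatten -!map_comp.
  elim: ts IH wts h1 {Pa sts} => //= t ts IHts IH wts h1; rewrite flatten_cat.
  apply: perm_cat.
    apply: IH; rewrite ?inE ?eqxx //; first by apply: wts; rewrite inE eqxx.
    by move=> C Ct; apply: h1; rewrite inE mem_cat Ct orbT.
  apply: IHts => [u uts|u uts|C]; first by apply: IH; rewrite inE uts orbT.
    by apply: wts; rewrite inE uts orbT.
  by rewrite inE => /orP[] Ct; apply: h1; rewrite inE ?mem_cat Ct ?orbT.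
case: a Pa sts h1 => [C|s] Pa sts h1; last by rewrite /= perm_cons.
apply: perm_trans (labels_vsubst_pattern _) _; first by rewrite size_map sts h1 // inE eqxx.
by rewrite perm_cat2l.
Qed.

(** This is what allows the pieces of a pattern to be derived separately: evaluating them one by one
    and assembling the results gives the value of the whole. *)
Lemma hom_flat theta (d : tree (tree (N + V))) :
  {in labels d, forall p, wf rk P p} ->
  (forall p C, p \in labels d -> inl C \in labels p ->
      {in vars (theta C), forall i, i < rk (inl C)}) ->
  hom g theta (flat d) = flat (relabel (hom g theta) d).
Proof.
elim/tree_ind_in: d => [i|p ds IH] //= h1 h2.
rewrite hom_vsubst.
- congr vsubst; rewrite -!map_comp; apply/eq_in_map => d dds; apply: IH => //.
    by move=> x xd; apply: h1; rewrite inE (mem_flatten_map dds xd) orbT.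
  by move=> x C xd; apply: h2; rewrite inE (mem_flatten_map dds xd) orbT.
- by apply: h1; rewrite inE eqxx.
- by move=> C; apply: h2; rewrite inE eqxx.
Qed.

End Hom.

(** The first hypothesis says that [g] sends terminals to terminals. The variable bounds are those
    under which [hom_vsubst] exchanges the outer homomorphism with substitution. *)
Lemma hom_hom (N V N' W X : eqType) (g : V -> N' + W) (g' : W -> X) (h : V -> X)
    (theta : N -> tree (N' + W)) (theta' : N' -> tree X) rk (P : pred (N' + W)) t :
  (forall s ts, hom g' theta' (Node (g s) ts) = Node (h s) (map (hom g' theta') ts)) ->
  (forall C, inl C \in labels t -> wf rk P (theta C)) ->
  (forall C D, inl C \in labels t -> inl D \in labels (theta C) ->
     {in vars (theta' D), forall i, i < rk (inl D)}) ->
  hom g' theta' (hom g theta t) = hom h (hom g' theta' \o theta) t.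
Proof.
move=> hg; elim/tree_ind_in: t => [i|a ts IH] // h1 h2.
have e : map (hom g' theta') (map (hom g theta) ts) = map (hom h (hom g' theta' \o theta)) ts.
  rewrite -map_comp; apply/eq_in_map => t tts; apply: IH => //.
    by move=> C Ct; apply: h1; rewrite inE (mem_flatten_map tts Ct) orbT.
  by move=> C D Ct; apply: h2; rewrite inE (mem_flatten_map tts Ct) orbT.
case: a h1 h2 => [C|s] h1 h2; last by rewrite [hom g _ _]/= hg e.
rewrite [hom g _ _]/= (@hom_vsubst _ _ _ _ rk P); last 2 first.
- by apply: h1; rewrite inE eqxx.
- by move=> D; apply: h2; rewrite inE eqxx.
by rewrite e.
Qed.

(** * Links and valuations of single nonterminals *)

Section Links.
Variable N : eqType.
Implicit Types (Ls : seq (seq N)).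

Definition link_of Ls (C : N) : seq N := nth [::] Ls (find (fun B => C \in B) Ls).

Definition disjoint_links Ls :=
  {in Ls &, forall B B', forall C, C \in B -> C \in B' -> B = B'}.

Lemma link_ofE Ls B C : disjoint_links Ls -> B \in Ls -> C \in B -> link_of Ls C = B.
Proof.
move=> dL BL CB; have hL : has (fun B => C \in B) Ls by apply/hasP; exists B.
apply: (dL _ _ _ BL C _ CB); first by rewrite mem_nth -?has_find.
exact: (nth_find [::] hL).
Qed.

Lemma map_nth_index (T : Type) (x0 : T) (B : seq N) (ts : seq T) :
  uniq B -> size ts = size B -> map (fun C => nth x0 ts (index C B)) B = ts.
Proof.
move=> uB sB; apply: (@eq_from_nth _ x0); rewrite size_map // => i iB.
have [c _] : exists c : N, True by case: (B) iB => // c; exists c.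
by rewrite (nth_map c) // index_uniq.
Qed.

(** Forests chosen for the links do not conflict, since a nonterminal lies in at most one link and
    at one position of it; so they assemble into one valuation. *)
Lemma choose_theta (T : Type) (x0 : T) Ls (Q : seq N -> seq T -> Prop) :
  disjoint_links Ls -> {in Ls, forall B, uniq B} ->
  {in Ls, forall B, exists2 ts, size ts = size B & Q B ts} ->
  exists theta : N -> T, {in Ls, forall B, Q B (map theta B)}.
Proof.
move=> dL uL h.
have /choice[F hF] : forall B, exists ts, B \in Ls -> size ts = size B /\ Q B ts.
  move=> B; have [BL|_] := boolP (B \in Ls); last by exists [::].
  by have [ts h1 h2] := h B BL; exists ts.
exists (fun C => nth x0 (F (link_of Ls C)) (index C (link_of Ls C))) => B BL.
have [s1 q] := hF B BL; rewrite (_ : map _ B = F B) //.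
rewrite -[RHS](map_nth_index x0 (uL B BL) s1); apply/eq_in_map => C CB.
by rewrite (link_ofE dL BL).
Qed.

End Links.

Section TermGen.
Variables (N : finType) (U : choiceType) (G : grammar N U).

(* L(G, A), with the derived forests seen as forests over the terminals. *)
Inductive tgen : seq N -> seq (tree U) -> Prop :=
| tgen_rule r theta : r \in rules G ->
    (forall B, B \in links r -> tgen B (map theta B)) ->
    tgen (lhs r) (map (ev theta) (rhs r)).

Variable rk : U -> nat.

Definition derivable_forest (A : seq N) (ts : seq (tree U)) :=
  all2 (fun C t => is_pattern rk (mem (terms G)) (nrk G C) t) A ts.

Definition nont (a : N + U) := if a is inl C then Some C else None.

Lemma mem_nont (C : N) (l : seq (N + U)) : (C \in pmap nont l) = (inl C \in l).
Proof.
elim: l => [//|[D|s] l IH] /=; last by rewrite IH inE.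
by rewrite !inE IH; congr (_ || _); apply/eqP/eqP => [->|[->]].
Qed.

Lemma mem_nonterms (C : N) (u : seq (tree (N + U))) :
  (C \in nonterms u) = (inl C \in flatten (map (@labels _) u)).
Proof. exact: mem_nont. Qed.

Lemma mem_nonterms_tree C t (u : seq (tree (N + U))) :
  t \in u -> inl C \in labels t -> C \in nonterms u.
Proof. by move=> tu Ct; rewrite mem_nonterms; apply: mem_flatten_map Ct. Qed.

Hypothesis GM : is_mcftg rk G.

Lemma links_disjoint r : r \in rules G -> disjoint_links (links r).
Proof.
case: GM => _ _ _ _ /[apply] -[_ _ _ _ [dL _]] B B' BL BL' C CB CB'.
apply/eqP/negPn/negP => ne; have := dL B B' BL BL' ne.
by move/pred0P/(_ C); rewrite /= CB CB'.
Qed.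

Lemma links_uniq r : r \in rules G -> {in links r, forall B, uniq B}.
Proof.
case: GM => h _ _ _ /[apply] -[_ _ _ /fsubsetP sub _] B /sub /h[] //.
Qed.

Lemma nonterms_links r C : r \in rules G -> C \in nonterms (rhs r) ->
  exists2 B, B \in links r & C \in B.
Proof. by case: GM => h _ _ _ /[apply] -[_ _ _ _ [_ dL]] /dL. Qed.

Lemma all2P (X Y : eqType) (R : X -> Y -> bool) s t :
  reflect (size s = size t /\ (forall x y, (x, y) \in zip s t -> R x y)) (all2 R s t).
Proof.
apply: (iffP idP).
  elim: s t => [|x s IH] [|y t] //= /andP[h /IH[-> h']]; split => // x' y'.
  by rewrite inE => /orP[/eqP[-> ->] //|/h'].
elim: s t => [|x s IH] [|y t] //= [ss h] //; apply/andP; split.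
  by apply: h; rewrite inE eqxx.
by apply: IH; split=> [|x' y' h']; [by case: ss|]; apply: h; rewrite inE h' orbT.
Qed.

Lemma zip_map_map (X X' Y Y' : Type) (f : X -> X') (g : Y -> Y') s t :
  zip (map f s) (map g t) = map (fun p => (f p.1, g p.2)) (zip s t).
Proof. by elim: s t => [|x s IH] [|y t] //=; rewrite IH. Qed.

Lemma zip_mapr (X Y Z : Type) (f : Y -> Z) (s : seq X) t :
  zip s (map f t) = map (fun p => (p.1, f p.2)) (zip s t).
Proof. by elim: s t => [|x s IH] [|y t] //=; rewrite IH. Qed.

Lemma mem_zip2 (X Y : eqType) (s : seq X) (t : seq Y) y : size s = size t ->
  y \in t -> exists2 x, x \in s & (x, y) \in zip s t.
Proof.
elim: s t => [|x s IH] [|z t] //= ss.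
rewrite inE => /orP[/eqP ->|/(IH _ (succn_inj ss))[x' h1 h2]].
  by exists x; rewrite inE eqxx.
by exists x'; rewrite inE ?h1 ?h2 orbT.
Qed.

Lemma rhs_pattern r t : r \in rules G -> t \in rhs r ->
  exists2 C, C \in lhs r & is_pattern (sym_rk rk G) (gsym G) (nrk G C) t.
Proof.
case: GM => _ _ _ _ /[apply] -[_ /all2P[ss h] _ _ _] tr.
have [C Cl z] := mem_zip2 ss tr; exists C => //; exact: h.
Qed.

Lemma derivable_forest_size A ts : derivable_forest A ts -> size ts = size A.
Proof. by case/all2P. Qed.

Lemma derivable_forest_map A (theta : N -> tree U) : derivable_forest A (map theta A) ->
  {in A, forall C, is_pattern rk (mem (terms G)) (nrk G C) (theta C)}.
Proof.
case/all2P => _ h C CA; apply: h.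
elim: A CA => //= D A IH; rewrite !inE => /orP[/eqP -> |/IH ->]; rewrite ?eqxx ?orbT //.
Qed.

Lemma rule_derivable r theta : r \in rules G ->
  (forall B, B \in links r -> derivable_forest B (map theta B)) ->
  derivable_forest (lhs r) (map (ev theta) (rhs r)).
Proof.
move=> rG h; case: GM => _ _ _ _ /(_ r rG)[_ /all2P[ss hp] _ _ _].
apply/all2P; rewrite size_map; split => // C t.
rewrite zip_mapr => /mapP[[D u] z [-> ->]] /=.
have tu : u \in rhs r.
  by have := map_f snd z; rewrite -/unzip2 unzip2_zip ?ss.
apply: hom_pattern; first exact: hp z.
  move=> E Eu; have [B BL EB] := nonterms_links rG (mem_nonterms_tree tu Eu).
  exact: derivable_forest_map (h B BL) _ EB.
by [].
Qed.

Lemma tgen_derivable A ts : tgen A ts -> derivable_forest A ts.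
Proof. by elim => r theta rG _ IH; apply: rule_derivable. Qed.

(** Both lists inside [link_subst] enumerate the links in the same order, and every nonterminal of
    the right-hand side occurs in some link, so looking up its index returns its value under
    [theta]. *)
Lemma link_substE r (f : seq N -> seq (tree (N + U))) theta : r \in rules G ->
  {in links r, forall B, f B = map (relabel inr) (map theta B)} ->
  link_subst (links r) f (rhs r) = map (relabel inr) (map (ev theta) (rhs r)).
Proof.
move=> rG h; rewrite /link_subst.
have -> : flatten (map f (links r)) = map (relabel inr \o theta) (flatten (links r)).
  rewrite map_flatten; congr flatten; apply/eq_in_map => B BL.
  by rewrite h // -map_comp.
rewrite -map_comp; apply/eq_in_map => t tr /=.
have : forall C, inl C \in labels t -> C \in flatten (links r).
  move=> C Ct; have [B BL CB] := nonterms_links rG (mem_nonterms_tree tr Ct).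
  by apply/flattenP; exists B.
elim/tree_ind_in: t {tr} => [i|a ts IH] //= hC.
have e : map (subst (map inl (flatten (links r)))
          (map (relabel inr \o theta) (flatten (links r)))) ts =
       map (relabel inr) (map (ev theta) ts).
  rewrite -map_comp; apply/eq_in_map => t tts; apply: IH => // C Ct; apply: hC.
  by rewrite inE (mem_flatten_map tts Ct) orbT.
rewrite e; case: a hC => [C|s] hC /=.
  have CL : C \in flatten (links r) by apply: hC; rewrite inE eqxx.
  rewrite mem_map ?CL; last by move=> ? ? [].
  rewrite index_map; last by move=> ? ? [].
  by rewrite (nth_map C) ?index_mem // nth_index // relabel_vsubst.
have -> : (inr s \in map inl (flatten (links r))) = false by apply/negbTE/mapP => -[].
by [].
Qed.

Lemma genP A ts : gen G A ts <-> exists2 us, ts = map (relabel inr) us & tgen A us.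
Proof.
split.
  elim=> r f rG _ IH.
  have [B BL|theta ht] := @choose_theta _ _ (Var 0) (links r)
      (fun B us => f B = map (relabel inr) us /\ tgen B us)
      (links_disjoint rG) (links_uniq rG).
    have [us e gus] := IH B BL.
    by exists us => //; apply/derivable_forest_size/tgen_derivable.
  exists (map (ev theta) (rhs r)).
    by apply: link_substE => // B BL; case: (ht B BL).
  by apply: tgen_rule => // B BL; case: (ht B BL).
case=> us ->; elim=> r theta rG _ IH.
rewrite -(link_substE (f := fun B => map (relabel inr) (map theta B))) //.
Qed.

Lemma langP t : lang G t <-> tgen [:: start G] [:: t].
Proof.
split; last by move=> h; apply/genP; exists [:: t].
case/genP => -[|u [|v us]] //= [e] h.
by rewrite (relabel_inj (h := inr) _ e) // => x y [].
Qed.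

End TermGen.

(** * Root consistency of MC-TAGs *)

Lemma zip_map_graph (X Y : eqType) (f : X -> Y) s x y :
  ((x, y) \in zip s (map f s)) = (x \in s) && (y == f x).
Proof.
rewrite -{1}[s]map_id zip_map; apply/mapP/andP => [[z zs [-> ->]]|[xs /eqP ->]].
  by rewrite zs eqxx.
by exists x.
Qed.

Section RootClass.
Variables (N : finType) (U : choiceType) (rk : U -> nat) (G : grammar N U).
Variable e : rel (N + U).
Hypothesis GM : is_mcftg rk G.
Hypothesis eE : {in gsym G & &, equivalence_rel e}.
Hypothesis eroot : {in rules G, forall r A t, (A, t) \in zip (lhs r) (rhs r) ->
   exists2 a, root_label t = Some a & e a (inl A)}.

(** If the right-hand side starts with a nonterminal [E], the root is that of the tree derived for
    [E], and the equivalence passes from [E] to the left-hand side by transitivity. *)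
Lemma tgen_root A ts : tgen G A ts -> forall C t, (C, t) \in zip A ts ->
  exists s, [/\ root_label t = Some s, s \in terms G & e (inr s) (inl C)].
Proof.
elim=> r theta rG _ IH C t.
rewrite zip_mapr => /mapP[[D u] z [-> ->]] /=.
have [a au ea] := eroot rG z.
have [_ _ _ _ /(_ r rG)[_ /all2P[ss hp] _ _ _]] := GM.
have ur : u \in rhs r by have := map_f snd z; rewrite -/unzip2 unzip2_zip ?ss.
have /andP[wu _] := hp _ _ z.
case: u au {hp} z ur wu => [//|a' us] /= [->] z ur /and3P[Pa _ _].
case: a ea ur Pa z => [E|s] ea ur Pa z; last by exists s.
have [|B BL EB] := nonterms_links GM rG (C := E).
  by apply: mem_nonterms_tree ur _; rewrite /= inE eqxx.
have [|s [rs st es]] := IH B BL E (theta E); first by rewrite zip_map_graph EB eqxx.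
exists s; split => //; first exact: root_vsubst.
by have [_ ->] := @eE (inr s) (inl E) (inl D) st isT isT.
Qed.

End RootClass.

Lemma mctag_root_consistent (N : finType) (U : choiceType) (rk : U -> nat)
  (G : grammar N U) : is_mctag rk G -> root_consistent rk (lang G).
Proof.
case=> GM _ [e [eE eT _ eR]] t t' a a' /(langP GM) ht /(langP GM) ht' ra ra' ne.
have eroot : {in rules G, forall r A t, (A, t) \in zip (lhs r) (rhs r) ->
   exists2 a, root_label t = Some a & e a (inl A)}.
  by move=> r rG A u z; case: (eR r rG A u z).
have [|s [rs st es]] := tgen_root GM eE eroot ht (C := start G) (t := t).
  by rewrite /= inE eqxx.
have [|s' [rs' st' es']] := tgen_root GM eE eroot ht' (C := start G) (t := t').
  by rewrite /= inE eqxx.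
move: rs rs'; rewrite ra ra' => -[?] [?]; subst s s'.
apply: eT => //.
have [_ h1] := @eE (inr a) (inl (start G)) (inr a') st isT st'.
rewrite h1 //.
have [_ h2] := @eE (inr a') (inl (start G)) (inr a') st' isT st'.
rewrite -h2 //.
by have [h3 _] := @eE (inr a') (inr a') (inr a') st' st' st'.
Qed.

(** * The MC-TAG of a root consistent language *)

Section Normalize.
Variables (N : finType) (U : choiceType) (rk : U -> nat) (G : grammar N U).
Hypothesis GM : is_mcftg rk G.
Variables (cl : U -> U) (c0 : U).
Hypothesis c0P : c0 \in map cl (terms G).

Definition classes : seq U := map cl (terms G).
Definition max_rank : nat := \max_(s <- terms G) rk s.
Definition max_nrank : nat := \max_(C : N) nrk G C.
Notation skel := (tree (U * nat)).
Notation skels := (skeletons classes max_rank max_nrank).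
Notation labs := (skel_labels classes max_rank).
Notation annot := (seq N * seq skel)%type.

(* A big nonterminal of G annotated with skeletons, one for each component. Its
   slots, the nonterminals of the new grammar, are numbered across the whole
   forest; each carries its annotation, so that slots of different annotations
   are distinct even if some components have no slots. *)
Definition slot_labels (b : annot) : seq (U * nat) := flatten (map (@labels _) b.2).

(** The skeleton of an uncut ground tree whose root has class [c0]. Its only slot will be the
    initial nonterminal. *)
Definition annot0 : annot := ([:: start G], [:: Node (c0, 0) [::]]).

Definition annots : seq annot :=
  annot0 :: [seq (A, ss) | A <- bigs G, ss <- seqs_over (size A) skels].

Definition slot_set : {fset annot * nat} :=
  seq_fset tt [seq (b, i) | b <- annots, i <- iota 0 (size (slot_labels b))].

Lemma mem_slot_set b i :
  ((b, i) \in slot_set) = (b \in annots) && (i < size (slot_labels b)).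
Proof.
rewrite seq_fsetE; apply/allpairsPdep/andP => [[b' [i' [h1 h2 [-> ->]]]]|[h1 h2]].
  by rewrite mem_iota in h2.
by exists b, i; rewrite mem_iota.
Qed.

Lemma slot0P : (annot0, 0) \in slot_set.
Proof. by rewrite mem_slot_set inE eqxx. Qed.

Definition slotT : finType := slot_set.
(** Indices out of range are sent to the slot of [annot0], which makes the function total. *)
Definition slot (b : annot) (i : nat) : slotT := insubd [` slot0P]%fset (b, i).
Definition slots (b : annot) : seq slotT :=
  map (slot b) (iota 0 (size (slot_labels b))).

Definition slot_info (C : slotT) : U * nat :=
  nth (c0, 0) (slot_labels (val C).1) (val C).2.

Lemma val_slot b i : b \in annots -> i < size (slot_labels b) -> val (slot b i) = (b, i).
Proof. by move=> hb hi; rewrite val_insubd mem_slot_set hb hi. Qed.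

Lemma slot_of b C : b \in annots -> C \in slots b -> (val C).1 = b.
Proof. by move=> hb /mapP[i]; rewrite mem_iota => hi ->; rewrite val_slot. Qed.

Lemma slots_uniq b : b \in annots -> uniq (slots b).
Proof.
move=> hb; rewrite map_inj_in_uniq ?iota_uniq // => i j.
rewrite !mem_iota => hi hj /(congr1 val); rewrite !val_slot //.
by case.
Qed.

Lemma size_slots b : size (slots b) = size (slot_labels b).
Proof. by rewrite size_map size_iota. Qed.

Lemma map_slot_info b : b \in annots -> map slot_info (slots b) = slot_labels b.
Proof.
move=> hb; rewrite -map_comp -[RHS](mkseq_nth (c0, 0)).
apply/eq_in_map => i; rewrite mem_iota => hi /=.
by rewrite /slot_info val_slot.
Qed.

Lemma annots_inj b b' C : b \in annots -> b' \in annots ->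
  C \in slots b -> C \in slots b' -> b = b'.
Proof. by move=> hb hb' /(slot_of hb) <- /(slot_of hb') <-. Qed.

Lemma annot_wf b : b \in annots -> {in b.2, forall s, wf snd (mem labs) s}.
Proof.
rewrite inE => /orP[/eqP -> s|].
  rewrite inE => /eqP -> /=; rewrite andbT.
  by apply: allpairs_f; [apply: c0P|rewrite mem_iota].
case/allpairsPdep => A [ss [AG hss ->]] s /= sss.
suff : s \in skels by rewrite mem_filter => /andP[].
move: hss sss; elim: (size A) ss => [|n IH] ss /=; first by rewrite inE => /eqP ->.
case/allpairsP => -[x s'] [/= h1 h2 ->]; rewrite inE => /orP[/eqP -> //|].
exact: IH h2.
Qed.

Lemma slot_info_labs C : slot_info C \in labs.
Proof.
case: C => -[b i] h; have := h; rewrite mem_slot_set => /andP[hb hi].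
rewrite /slot_info /=; have /flattenP[_ /mapP[s sb ->] xs] := mem_nth (c0, 0) hi.
exact: (allP (wf_labels (annot_wf hb sb)) _ xs).
Qed.

Definition sk_nrk (C : slotT) : nat := (slot_info C).2.
Notation sym := (slotT + U)%type.
Definition sk_rk (a : sym) : nat :=
  match a with inl C => sk_nrk C | inr s => rk s end.
Definition sk_sym : pred sym := fun a => if a is inr s then s \in terms G else true.
Definition sk_class (a : sym) : U :=
  match a with inl C => (slot_info C).1 | inr s => cl s end.

Lemma labs_bound c n : (c, n) \in labs -> c \in classes /\ n <= max_rank.
Proof. by case/allpairsP => -[c' n'] [h1 h2 [-> ->]]; move: h2; rewrite mem_iota. Qed.

Lemma sk_class_mem a : sk_sym a -> sk_class a \in classes.
Proof.
case: a => [C|s] /=; last by move=> h; apply: map_f.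
move=> _; have := slot_info_labs C; case: (slot_info C) => c n /labs_bound[] //.
Qed.

Lemma sk_rk_le a : sk_sym a -> sk_rk a <= max_rank.
Proof.
case: a => [C _|s hs] /=; last by rewrite /max_rank (big_rem s hs) leq_maxl.
rewrite /sk_nrk; have := slot_info_labs C.
by case: (slot_info C) => c n /labs_bound[].
Qed.

(** These forests replace the components of a big nonterminal of [G] in a right-hand side: skeletons
    whose nodes are nonterminals of the new grammar. *)
Definition nforest (b : annot) : seq (tree sym) :=
  map (relabel (fun i => inl (slot b i))) (numbers 0 b.2).

Lemma size_nforest b : size (nforest b) = size b.2.
Proof. by rewrite size_map size_numbers. Qed.

Lemma nforest_info b : b \in annots ->
  map (relabel (fun a => (sk_class a, sk_rk a))) (nforest b) = b.2.
Proof.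
move=> hb; rewrite -map_comp -[RHS]map_id.
rewrite (eq_map (g := relabel (slot_info \o slot b))); last first.
  move=> t /=; rewrite relabel_comp; apply: eq_in_relabel => i _.
  by rewrite /= /sk_nrk -surjective_pairing.
rewrite -[in RHS](eq_map (f := relabel id)); last first.
  move=> t; elim/tree_ind_in: t => [i|a ts IH] //=; congr Node.
  by rewrite -[RHS]map_id; apply/eq_in_map.
by apply: relabel_numbers; rewrite map_id map_comp; apply: map_slot_info.
Qed.

Lemma labels_nforest b : flatten (map (@labels _) (nforest b)) = map inl (slots b).
Proof.
rewrite /slots -map_comp /slot_labels -labels_numbers map_flatten -!map_comp; congr flatten.
by apply/eq_in_map => t _ /=; rewrite labels_relabel.
Qed.

(** The invariant of both simulations: plugging the patterns derived from the slots into the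
    skeletons must give a forest that [G] derives. *)
Definition decode (b : annot) (theta : slotT -> tree U) : seq (tree U) :=
  map (ev theta) (nforest b).

Lemma decodeE b theta :
  decode b theta = map (@flat _) (map (relabel (theta \o slot b)) (numbers 0 b.2)).
Proof.
rewrite /decode -!map_comp; apply/eq_in_map => t _ /=.
exact: hom_relabel_inl.
Qed.

Lemma eq_decode b theta theta' : {in slots b, theta =1 theta'} ->
  decode b theta = decode b theta'.
Proof.
move=> e; apply/eq_in_map => t tb; apply: eq_in_hom => C Ct; apply: e.
rewrite -(mem_map (f := @inl slotT U)); last by move=> ? ? [].
by rewrite -labels_nforest; apply: mem_flatten_map Ct.
Qed.

(* As the links of a rule are disjoint, skeletons can be chosen for single
   nonterminals instead of big ones. *)
Definition annotation : finType := {ffun N -> seq_sub skels}.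
Implicit Types (r : rule N U) (sg : annotation).

Definition ann sg (B : seq N) : annot := (B, map (fun C => val (sg C)) B).

Definition eta r sg (C : N) : tree sym :=
  let B := link_of (links r) C in nth (Var 0) (nforest (ann sg B)) (index C B).

Definition expand r sg : seq (tree sym) := map (hom inr (eta r sg)) (rhs r).

Definition is_split (t : tree sym) (d : tree (tree sym)) : Prop :=
  [/\ flat d = t, decomposition c0 sk_rk sk_sym sk_class max_rank d &
      reduced (cls c0 sk_class) d].

(** Classical choice turns the existence of a cut into a function; any cut will do. *)
Definition split t : tree (tree sym) := xget (Var 0) [set d | is_split t d]%classic.

Lemma splitP t : wf sk_rk sk_sym t -> is_split t (split t).
Proof. by move=> wt; apply: xgetPex; apply: decomp_exists => //; apply: sk_rk_le. Qed.

Definition pieces r sg : seq (tree sym) :=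
  flatten (map (@labels _) (map split (expand r sg))).

Definition piece_info : tree sym -> U * nat := info c0 sk_class.

Definition rule_annot r sg : annot :=
  (lhs r, map (relabel piece_info) (map split (expand r sg))).

Definition sk_rule r sg : rule slotT U :=
  Rule (slots (rule_annot r sg)) (pieces r sg)
    (seq_fset tt [seq slots (ann sg B) | B <- links r & slots (ann sg B) != [::]]).

Definition skeleton_annot (b : annot) : Prop :=
  all2 (fun C s => skeleton classes max_rank (nrk G C) s) b.1 b.2.

(* A link whose patterns are all trivial (the identity pattern x_1) has no slots
   and disappears from the rule; it must have a derivation in G. *)
Definition admissible r sg : Prop :=
  forall B, B \in links r -> skeleton_annot (ann sg B) /\
    (slots (ann sg B) = [::] -> forall theta, tgen G B (decode (ann sg B) theta)).

(** Admissibility speaks of derivability and is decided classically. A rule all of whose patterns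
    are trivial would have an empty left-hand side and is left out; [admissible] accounts for its
    effect. *)
Definition sk_rules : {fset rule slotT U} :=
  seq_fset tt [seq sk_rule p.1 p.2 |
    p <- [seq (r, sg) | r <- rules G, sg <- enum annotation] &
    `[< admissible p.1 p.2 >] && (slots (rule_annot p.1 p.2) != [::])].

Definition sk_grammar : grammar slotT U :=
  Grammar sk_nrk (seq_fset tt [seq slots b | b <- annots & slots b != [::]])
    (terms G) (slot annot0 0) sk_rules.

Lemma sk_rulesP x : x \in sk_rules -> exists r sg,
  [/\ x = sk_rule r sg, r \in rules G, admissible r sg &
      slots (rule_annot r sg) != [::]].
Proof.
rewrite seq_fsetE => /mapP[p]; rewrite mem_filter => /andP[/andP[/asboolP h1 h2]].
by case/allpairsP => q [h3 h4 e] ->; exists p.1, p.2; split => //; rewrite e.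
Qed.

Lemma mem_sk_rules r sg : r \in rules G -> admissible r sg ->
  slots (rule_annot r sg) != [::] -> sk_rule r sg \in sk_rules.
Proof.
move=> rG h1 h2; rewrite seq_fsetE.
apply: (@map_f _ _ (fun p => sk_rule p.1 p.2) _ (r, sg)).
rewrite mem_filter h2 andbT; apply/andP; split; first exact/asboolP.
by apply: allpairs_f; rewrite ?mem_enum.
Qed.

Lemma mem_sk_bigs X :
  (X \in bigs sk_grammar) = (X \in [seq slots b | b <- annots & slots b != [::]]).
Proof. exact: seq_fsetE. Qed.

Lemma mem_sk_links r sg X : (X \in links (sk_rule r sg)) =
  (X \in [seq slots (ann sg B) | B <- links r & slots (ann sg B) != [::]]).
Proof. exact: seq_fsetE. Qed.

Lemma skeleton_annot_mem b : b.1 \in bigs G -> skeleton_annot b -> b \in annots.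
Proof.
case: b => A ss /= AG /all2P[sA h]; rewrite inE; apply/orP; right.
apply: (@allpairs_f_dep _ (fun=> seq skel) _ (fun A ss => (A, ss))) => //=.
apply: mem_seqs_over => // s sss; have [C CA z] := mem_zip2 sA sss.
by apply: (mem_skeletons (h _ _ z)); rewrite /max_nrank leq_bigmax.
Qed.

(** * Correctness of a single rule *)

Section OneRule.
Variables (r : rule N U) (sg : annotation).
Hypothesis rG : r \in rules G.
Hypothesis adm : admissible r sg.

Lemma ann_mem B : B \in links r -> ann sg B \in annots.
Proof.
move=> BL; apply: skeleton_annot_mem; last by case: (adm BL).
by case: GM => _ _ _ _ /(_ r rG)[_ _ _ /fsubsetP /(_ B BL)].
Qed.

Lemma ann_skeleton B C : B \in links r -> C \in B ->
  skeleton classes max_rank (nrk G C) (val (sg C)).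
Proof.
move=> BL CB; have [/all2P[_ h] _] := adm BL; apply: h => /=.
by rewrite zip_map_graph CB eqxx.
Qed.

Lemma etaE B C : B \in links r -> C \in B ->
  eta r sg C = nth (Var 0) (nforest (ann sg B)) (index C B).
Proof. by move=> BL CB; rewrite /eta (link_ofE (links_disjoint GM rG) BL CB). Qed.

Lemma map_eta B : B \in links r -> map (eta r sg) B = nforest (ann sg B).
Proof.
move=> BL; rewrite -[RHS](map_nth_index (Var 0) (links_uniq GM rG BL)).
  by apply/eq_in_map => C CB; rewrite (etaE BL).
by rewrite size_nforest size_map.
Qed.

Lemma eta_pattern B C : B \in links r -> C \in B ->
  is_pattern sk_rk sk_sym (nrk G C) (eta r sg C).
Proof.
move=> BL CB; have iB : index C B < size B by rewrite index_mem.
(* Slots have the class and rank recorded in the skeleton, so the pattern property of the chosen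
   skeleton transfers to [eta]. *)
have e : relabel (fun a => (sk_class a, sk_rk a)) (eta r sg C) = val (sg C).
  have := congr1 (fun l => nth (Var 0) l (index C B)) (nforest_info (ann_mem BL)).
  rewrite (nth_map (Var 0)) ?size_nforest ?size_map // -(etaE BL CB).
  by rewrite (nth_map C) // nth_index.
have /and3P[w p _] := ann_skeleton BL CB.
rewrite -e wf_relabel vars_relabel in w p; rewrite /is_pattern p andbT.
have [t' et] : exists t', eta r sg C = relabel inl t' :> tree sym.
  rewrite (etaE BL CB) /nforest (nth_map (Var 0)); last by rewrite size_numbers size_map.
  exists (relabel (slot (ann sg B)) (nth (Var 0) (numbers 0 (ann sg B).2) (index C B))).
  by rewrite relabel_comp.
rewrite -(eq_in_wf (rk := sk_rk) (P := mem labs \o (fun a => (sk_class a, sk_rk a)))) //.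
move=> a ha /=; have := allP (wf_labels w) a ha; move=> /= ->.
by move: ha; rewrite et labels_relabel => /mapP[D _ ->].
Qed.

Lemma rhs_link t C : t \in rhs r -> inl C \in labels t ->
  exists2 B, B \in links r & C \in B.
Proof. by move=> tr Ct; apply: (nonterms_links GM rG); apply: mem_nonterms_tree Ct. Qed.

Lemma expand_pattern k t : t \in rhs r -> is_pattern (sym_rk rk G) (gsym G) k t ->
  is_pattern sk_rk sk_sym k (hom inr (eta r sg) t).
Proof.
move=> tr pt; apply: hom_pattern pt _ _ => // C Ct.
by have [B BL CB] := rhs_link tr Ct; apply: eta_pattern BL CB.
Qed.

Lemma expand_wf t : t \in expand r sg -> wf sk_rk sk_sym t.
Proof.
case/mapP=> u ur ->; have [C _ pu] := rhs_pattern GM rG ur.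
by case/andP: (expand_pattern ur pu).
Qed.

Lemma split_expand : map (@flat _) (map split (expand r sg)) = expand r sg.
Proof.
rewrite -map_comp -[RHS]map_id; apply/eq_in_map => t /expand_wf /splitP[] //.
Qed.

Lemma pieceP p : p \in pieces r sg -> piece c0 sk_rk sk_sym sk_class max_rank p.
Proof.
case/flattenP => _ /mapP[_ /mapP[t tr ->] ->] pt.
by have [_ [_ h] _] := splitP (expand_wf tr); apply: h.
Qed.

Lemma piece_info_labs p : p \in pieces r sg -> piece_info p \in labs.
Proof.
move=> /pieceP[pp sp rp fp]; case: p pp sp rp fp => [//|a ts] pp sp rp fp.
apply: allpairs_f; last by rewrite mem_iota.
by apply: sk_class_mem; case/andP: pp => /andP[].
Qed.

Lemma slot_labels_rule : slot_labels (rule_annot r sg) = map piece_info (pieces r sg).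
Proof.
rewrite /slot_labels /pieces /= map_flatten -!map_comp; congr flatten.
by apply/eq_in_map => t _ /=; rewrite labels_relabel.
Qed.

(** This closes the construction: the skeletons obtained by cutting a right-hand side belong to the
    same bounded family as those guessed for its links. *)
Lemma rule_annot_skeleton : skeleton_annot (rule_annot r sg).
Proof.
case: GM => _ _ _ _ /(_ r rG)[_ /all2P[ss hp] _ _ _].
apply/all2P => /=; rewrite !size_map; split => // C s.
rewrite !zip_mapr -!map_comp => /mapP[[D u] z [-> ->]] /=.
have ur : u \in rhs r by have := map_f snd z; rewrite -/unzip2 unzip2_zip ?ss.
have pu := expand_pattern ur (hp _ _ z).
have te : hom inr (eta r sg) u \in expand r sg by apply: map_f.
have [e1 e2 e3] := splitP (expand_wf te).
apply/and3P; split.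
- rewrite wf_relabel; case: (e2) => w _.
  rewrite -(eq_in_wf (rk := fun p => size (vars p)) (P := predT)) // => p pl.
  rewrite /= piece_info_labs //; apply/flattenP.
  exists (labels (split (hom inr (eta r sg) u))) => //.
  by rewrite -map_comp; apply: (map_f (@labels _ \o split)).
- rewrite vars_relabel; case/andP: pu => _; apply: perm_trans.
  by have := vars_flat e2; rewrite e1 perm_sym.
- by rewrite reduced_relabel.
Qed.

Lemma rule_annot_mem : rule_annot r sg \in annots.
Proof.
apply: skeleton_annot_mem; last exact: rule_annot_skeleton.
by case: GM => _ _ _ _ /(_ r rG)[].
Qed.

Lemma piece_slots : zip (slots (rule_annot r sg)) (pieces r sg) =
  [seq (slot (rule_annot r sg) i, nth (Var 0) (pieces r sg) i)
     | i <- iota 0 (size (pieces r sg))].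
Proof.
rewrite -{1}[pieces r sg](mkseq_nth (Var 0)) /slots slot_labels_rule size_map /mkseq.
by rewrite zip_map.
Qed.

Lemma piece_slotP C p : (C, p) \in zip (slots (rule_annot r sg)) (pieces r sg) ->
  p \in pieces r sg /\ slot_info C = piece_info p.
Proof.
rewrite piece_slots => /mapP[i]; rewrite mem_iota add0n => /= hi [-> ->].
split; first exact: mem_nth.
rewrite /slot_info val_slot ?rule_annot_mem ?slot_labels_rule ?size_map //=.
by rewrite (nth_map (Var 0)).
Qed.

Lemma size_slots_rule : size (slots (rule_annot r sg)) = size (pieces r sg).
Proof. by rewrite size_slots slot_labels_rule size_map. Qed.

Lemma labels_pieces : perm_eq (flatten (map (@labels _) (pieces r sg)))
  (flatten (map (@labels _) (expand r sg))).
Proof.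
rewrite -{1}split_expand /pieces map_flatten flatten_flatten -!map_comp perm_sym.
apply: perm_flatten_in => t tr /=.
by have [_ /labels_flat h _] := splitP (expand_wf (map_f _ tr)).
Qed.

(** Cutting only regroups labels, and expansion replaces each nonterminal, which occurs once, by its
    slots. Hence every slot of every link occurs exactly once. *)
Lemma nonterms_pieces : perm_eq (nonterms (pieces r sg))
  (flatten [seq slots (ann sg B) | B <- links r]).
Proof.
have -> (u : seq (tree sym)) :
    nonterms u = pmap (@nont slotT U) (flatten (map (@labels _) u)) by [].
have pe : perm_eq (flatten (map (@labels _) (expand r sg)))
   (flatten [seq match a with inl C => labels (eta r sg C) | inr s => [:: inr s] end
     | a <- flatten (map (@labels _) (rhs r))]).
  rewrite map_flatten flatten_flatten -!map_comp.
  apply: perm_flatten_in => t tr /=.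
  have [C _ /andP[wt _]] := rhs_pattern GM rG tr.
  apply: (labels_hom inr wt) => D Dt; have [B BL DB] := rhs_link tr Dt.
  by case/andP: (eta_pattern BL DB).
apply: perm_trans (perm_pmap _ (perm_trans labels_pieces pe)) _.
have pn : perm_eq (nonterms (rhs r)) (flatten (links r)).
  case: GM => _ _ _ _ /(_ r rG)[_ _ un _ [_ hl]].
  apply: uniq_perm => //.
    rewrite -[enum_fset _]map_id; apply: uniq_flatten_map => //=.
    - exact: (links_uniq GM rG).
    - exact: (links_disjoint GM rG).
  move=> C; apply/idP/flattenP => [/hl[B]|[B BL CB]]; first by exists B.
  by apply/hl; exists B.
have -> (l : seq (N + U)) : pmap (@nont slotT U)
    (flatten [seq match a with inl C => labels (eta r sg C) | inr s => [:: inr s] end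
       | a <- l]) =
    flatten [seq pmap (@nont slotT U) (labels (eta r sg C)) | C <- pmap (@nont N U) l].
  elim: l => [//|[C|s] l IH] /=; first by rewrite pmap_cat IH.
  by rewrite IH.
apply: perm_trans (perm_flatten (perm_map _ pn)) _.
rewrite map_flatten flatten_flatten -map_comp; apply: perm_flatten_in => B BL /=.
have := congr1 (pmap (@nont slotT U)) (labels_nforest (ann sg B)).
rewrite -(map_eta BL) -map_comp => e.
rewrite (_ : flatten _ = slots (ann sg B)) //.
rewrite (map_pK (f := @nont slotT U)) // in e.
rewrite -[RHS]e; elim: (B) => //= C s ->; by rewrite pmap_cat.
Qed.

Lemma sk_rule_valid : slots (rule_annot r sg) != [::] ->
  valid_rule rk sk_grammar (sk_rule r sg).
Proof.
move=> ne; split.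
- rewrite mem_sk_bigs; apply: (map_f slots); by rewrite mem_filter ne rule_annot_mem.
- apply/all2P; rewrite size_slots_rule; split => // C p /piece_slotP[pp ei].
  by have [h _ _ _] := pieceP pp; rewrite /= /sk_nrk ei.
- rewrite /= (perm_uniq nonterms_pieces).
  apply: uniq_flatten_map => [|B BL|B B' BL BL' C h h']; first exact: fset_uniq.
    exact/slots_uniq/ann_mem.
  by have [] := annots_inj (ann_mem BL) (ann_mem BL') h h'.
- apply/fsubsetP => X; rewrite mem_sk_links mem_sk_bigs => /mapP[B].
  rewrite mem_filter => /andP[h BL] ->; apply: (map_f slots).
  by rewrite mem_filter h ann_mem.
split.
  move=> X X'; rewrite !mem_sk_links => /mapP[B]; rewrite mem_filter => /andP[_ BL] ->.
  move=> /mapP[B']; rewrite mem_filter => /andP[_ BL'] -> neq.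
  apply/pred0P => C /=; apply/negP => /andP[h h'].
  have e := annots_inj (ann_mem BL) (ann_mem BL') h h'.
  by rewrite e eqxx in neq.
move=> C; rewrite /= (perm_mem nonterms_pieces); split.
  case/flattenP => _ /mapP[B BL ->] h; exists (slots (ann sg B)) => //.
  rewrite mem_sk_links; apply: (map_f (slots \o ann sg)); rewrite mem_filter BL andbT.
  by apply/eqP => e; rewrite e in h.
case=> X; rewrite mem_sk_links => /mapP[B]; rewrite mem_filter => /andP[_ BL] -> h.
by apply: (mem_flatten_map (F := slots \o ann sg)) h.
Qed.

(** One step of [G] corresponds to one step of the new grammar. By [hom_hom], the values in [G] are
    those of the expanded right-hand side; by [hom_flat], they are assembled from the values of the
    pieces. Both inclusions of the languages use this. *)
Lemma rule_step (theta : N -> tree U) (theta' theta'' : slotT -> tree U) :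
  (forall B, B \in links r -> {in slots (ann sg B), forall C,
     {in vars (theta' C), forall i, i < sk_nrk C}}) ->
  (forall B, B \in links r -> map theta B = decode (ann sg B) theta') ->
  map theta'' (slots (rule_annot r sg)) = map (ev theta') (pieces r sg) ->
  map (ev theta) (rhs r) = decode (rule_annot r sg) theta''.
Proof.
move=> hv hd hp.
have hv' t C : t \in expand r sg -> inl C \in labels t ->
    {in vars (theta' C), forall i, i < sk_nrk C}.
  move=> te Ct; have := mem_flatten_map te Ct.
  have : C \in nonterms (expand r sg) -> {in vars (theta' C), forall i, i < sk_nrk C}.
    have -> : C \in nonterms (expand r sg) = (C \in nonterms (pieces r sg)).
      by rewrite !mem_nonterms (perm_mem labels_pieces).
    rewrite (perm_mem nonterms_pieces) => /flattenP[_ /mapP[B BL ->] CB].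
    exact: (hv B BL C CB).
  by rewrite mem_nonterms => h /h.
have e1 : map (ev theta) (rhs r) = map (ev theta') (expand r sg).
  rewrite -map_comp; apply/eq_in_map => t tr /=.
  rewrite (@hom_hom _ _ _ _ _ _ _ id _ _ sk_rk sk_sym) //; last first.
  - move=> C D Ct Dt; have [B BL CB] := rhs_link tr Ct.
    apply: (hv B) => //.
    rewrite -(mem_map (f := @inl slotT U)); last by move=> ? ? [].
    rewrite -labels_nforest -(map_eta BL); apply: mem_flatten_map Dt.
    exact: map_f.
  - move=> C Ct; have [B BL CB] := rhs_link tr Ct.
    by case/andP: (eta_pattern BL CB).
  apply: eq_in_hom => C Ct /=; have [B BL CB] := rhs_link tr Ct.
  have := congr1 (fun l => nth (Var 0) l (index C B)) (hd B BL).
  have iB : index C B < size B by rewrite index_mem.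
  rewrite /decode -(map_eta BL) -map_comp !(nth_map C) // nth_index //.
rewrite e1 -{1}split_expand decodeE /= -map_comp.
(* The slots on the left are numbered in preorder, the order in which [pieces] lists the pieces, so
   [relabel_numbers] matches them. *)
have -> : map (relabel (theta'' \o slot (rule_annot r sg)))
    (numbers 0 (map (relabel piece_info) (map split (expand r sg)))) =
    map (relabel (ev theta')) (map split (expand r sg)).
  rewrite numbers_relabel; apply: relabel_numbers; rewrite -/(pieces r sg) -hp.
  by rewrite /slots -map_comp slot_labels_rule size_map.
rewrite -!map_comp; apply/eq_in_map => t te /=.
have {}te := map_f (hom inr (eta r sg)) te.
have [f1 [f2 f3] f4] := splitP (expand_wf te).
apply: (@hom_flat _ _ _ _ sk_rk sk_sym).
  by move=> p /f3[/andP[]].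
move=> p C pt Cp; apply: (hv' _ _ te).
by rewrite -{1}f1 (perm_mem (labels_flat (conj f2 f3))); apply: mem_flatten_map Cp.
Qed.

End OneRule.

Lemma slots0 : slots annot0 = [:: slot annot0 0].
Proof. by []. Qed.

Lemma annot0_mem : annot0 \in annots.
Proof. by rewrite inE eqxx. Qed.

Lemma sk_grammar_mcftg : is_mcftg rk sk_grammar.
Proof.
case: (GM) => _ _ hs _ _; split.
- move=> X; rewrite mem_sk_bigs => /mapP[b]; rewrite mem_filter => /andP[ne hb] ->.
  by split => //; apply: slots_uniq.
- move=> X X'; rewrite !mem_sk_bigs => /mapP[b]; rewrite mem_filter => /andP[ne hb] ->.
  move=> /mapP[b']; rewrite mem_filter => /andP[_ hb'] -> e.
  case E: (slots b) ne => [//|C l] _; have Cb : C \in slots b by rewrite E inE eqxx.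
  by rewrite -E (annots_inj hb hb' Cb) // -e.
- exact: hs.
- split; last by rewrite /= /sk_nrk /slot_info val_slot ?annot0_mem.
  rewrite mem_sk_bigs -slots0; apply: (map_f slots).
  by rewrite mem_filter annot0_mem slots0.
- by move=> x /sk_rulesP[r [sg [-> rG adm ne]]]; apply: sk_rule_valid.
Qed.

Definition same_class : rel sym := fun a b => sk_class a == sk_class b.

Lemma same_class_equivalence : {in gsym sk_grammar & &, equivalence_rel same_class}.
Proof.
move=> x y z _ _ _; split; first exact: eqxx.
by rewrite /same_class => /eqP ->.
Qed.

Lemma sk_rule_class : {in rules sk_grammar, forall x C p, (C, p) \in zip (lhs x) (rhs x) ->
  (exists2 a, root_label p = Some a & same_class a (inl C)) /\
  (0 < sk_nrk C -> exists2 a, foot_label (sk_nrk C) a p & same_class a (inl C))}.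
Proof.
move=> x /sk_rulesP[r [sg [-> rG adm ne]]] C p /(piece_slotP rG adm)[pp ei].
have [_ _ rp fp] := pieceP rG adm pp.
rewrite /same_class /= /sk_nrk ei; split.
  by case: p {fp pp ei} rp => [//|a ts] _; exists a.
by move=> /fp [a fa ca]; exists a => //; apply/eqP.
Qed.

Hypothesis cl_rank : {in terms G &, forall s s', s <> s' -> cl s = cl s' -> rk s <> rk s'}.

Lemma sk_grammar_mctag : is_mctag rk sk_grammar.
Proof.
split; first exact: sk_grammar_mcftg.
  move=> x xR C p z; have [_ h] := sk_rule_class xR z.
  case: (posnP (nrk sk_grammar C)) => [|n0]; first by left.
  by right; split => //; have [a fa _] := h n0; exists a.
exists same_class; split.
- exact: same_class_equivalence.
- by move=> s s' hs hs' ne /eqP; apply: cl_rank.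
- move=> C; have /mapP[s hs e] := @sk_class_mem (inl C) isT.
  by exists s => //; apply/eqP.
- exact: sk_rule_class.
Qed.

(** The annotation is recovered from the sequence of slots, since each slot carries it. The
    derivation in [G] evaluates every nonterminal to its skeleton with the derived patterns plugged
    in. *)
Lemma sk_sound X ps : tgen sk_grammar X ps -> exists b theta,
  [/\ b \in annots, X = slots b, ps = map theta X & tgen G b.1 (decode b theta)].
Proof.
elim=> x theta /sk_rulesP[r [sg [-> rG adm ne]]] hX IH.
have hb := rule_annot_mem rG adm.
have sp : size (map (ev theta) (pieces r sg)) = size (slots (rule_annot r sg)).
  by rewrite size_map size_slots_rule.
exists (rule_annot r sg); eexists; split => //.
  by rewrite [LHS]/= -(map_nth_index (Var 0) (slots_uniq hb) sp).
have hlink B : B \in links r -> slots (ann sg B) != [::] ->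
    slots (ann sg B) \in links (sk_rule r sg).
  move=> BL neB; rewrite mem_sk_links; apply: (map_f (slots \o ann sg)).
  by rewrite mem_filter neB BL.
rewrite -(@rule_step r sg rG adm (fun C => ev theta (eta r sg C)) theta) //.
- apply: tgen_rule => // B BL.
  rewrite (_ : map _ B = decode (ann sg B) theta); last first.
    by rewrite /decode -(map_eta _ rG BL) -map_comp.
  (* A link without slots is absent from the new rule, so the induction hypothesis says nothing
     about it; admissibility supplies the derivation. *)
  have [/eqP e|neB] := boolP (slots (ann sg B) == [::]).
    by case: (adm B BL) => _; apply.
  have [b [theta2 [h1 h2 h3 h4]]] := IH _ (hlink B BL neB).
  case E: (slots (ann sg B)) neB => [//|C l] _.
  have Cb : C \in slots (ann sg B) by rewrite E inE eqxx.
  have eb : ann sg B = b by apply: (annots_inj (ann_mem rG adm BL) h1 Cb); rewrite -h2.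
  rewrite (@eq_decode _ theta theta2); first by rewrite eb -[B]/((ann sg B).1) eb.
  by move=> D Db; have /eq_in_map := h3; apply.
- move=> B BL C Cb.
  have neB : slots (ann sg B) != [::] by apply/eqP => e; rewrite e in Cb.
  have /derivable_forest_map h := tgen_derivable sk_grammar_mcftg (hX _ (hlink B BL neB)).
  exact: pattern_vars_lt (h C Cb).
- by move=> B BL; rewrite /decode -(map_eta _ rG BL) -map_comp.
- exact: map_nth_index (slots_uniq hb) sp.
Qed.

Lemma leaf_skeleton c : c \in classes -> Node (c, 0) [::] \in skels.
Proof.
move=> hc; apply: (@mem_skeletons _ _ _ 0) => //.
rewrite /skeleton /= !andbT; apply: allpairs_f => //; by rewrite mem_iota.
Qed.

Lemma sk_complete A ts : tgen G A ts -> exists b theta,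
  [/\ b.1 = A, skeleton_annot b, decode b theta = ts &
      slots b != [::] -> tgen sk_grammar (slots b) (map theta (slots b))].
Proof.
elim=> r theta rG hB IH.
have /choice[F hF] : forall B, exists F : annot * (slotT -> tree U), B \in links r ->
  [/\ F.1.1 = B, skeleton_annot F.1, decode F.1 F.2 = map theta B &
      slots F.1 != [::] -> tgen sk_grammar (slots F.1) (map F.2 (slots F.1))].
  move=> B; have [BL|_] := boolP (B \in links r); last by exists (annot0, fun=> Var 0).
  by have [b [theta' h]] := IH B BL; exists (b, theta').
(* The skeletons found for the links are gathered into one function; the leaf skeleton is a mere
   default. *)
pose sg : annotation := [ffun C => insubd (SeqSub (leaf_skeleton c0P))
   (nth (Var 0) (F (link_of (links r) C)).1.2 (index C (link_of (links r) C)))].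
(* A slot knows its annotation, whose first component is the link; this selects the valuation to be
   used. *)
pose theta' (D : slotT) := (F (val D).1.1).2 D.
have annE B : B \in links r -> ann sg B = (F B).1.
  move=> BL; have [f1 f2 _ _] := hF B BL; case eF: (F B).1 f1 f2 => [A' ss] /= eA.
  rewrite /ann {A'}eA in eF *; move=> /all2P[/= sB hs]; congr (_, _).
  rewrite -[RHS](map_nth_index (Var 0) (links_uniq GM rG BL)) //.
  apply/eq_in_map => C CB; rewrite ffunE (link_ofE (links_disjoint GM rG) BL CB) eF /=.
  rewrite val_insubd; case: ifP => // /negP[].
  have iB : index C B < size B by rewrite index_mem.
  apply: (@mem_skeletons _ _ _ (nrk G C)); last by rewrite /max_nrank leq_bigmax.
  apply: hs; have := @mem_nth _ (C, Var 0) (zip B ss) (index C B).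
  by rewrite nth_zip // nth_index // size_zip -sB minnn; apply.
have adm0 B : B \in links r -> skeleton_annot (ann sg B).
  by move=> BL; rewrite annE //; case: (hF B BL).
have bigB B : B \in links r -> ann sg B \in annots.
  move=> BL; apply: skeleton_annot_mem; last exact: adm0.
  by case: GM => _ _ _ _ /(_ r rG)[_ _ _ /fsubsetP /(_ B BL)].
have thetaE B : B \in links r -> {in slots (ann sg B), theta' =1 (F B).2}.
  by move=> BL D /(slot_of (bigB B BL)) e; rewrite /theta' e.
have decE B : B \in links r -> decode (ann sg B) theta' = map theta B.
  by move=> BL; rewrite (eq_decode (thetaE B BL)) annE //; case: (hF B BL).
have genB B : B \in links r -> slots (ann sg B) != [::] ->
    tgen sk_grammar (slots (ann sg B)) (map theta' (slots (ann sg B))).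
  move=> BL neB; have /eq_in_map -> := thetaE B BL; rewrite annE // in neB *.
  by case: (hF B BL) => _ _ _; apply.
have adm : admissible r sg.
  move=> B BL; split; first exact: adm0.
  (* Without slots, decoding does not depend on the valuation, so it gives the forest that [G]
     derives for this link. *)
  move=> e th; rewrite (@eq_decode _ th theta'); first by rewrite decE //; apply: hB.
  by move=> D; rewrite e.
have hb := rule_annot_mem rG adm.
have sp : size (map (ev theta') (pieces r sg)) = size (slots (rule_annot r sg)).
  by rewrite size_map size_slots_rule.
have hp := map_nth_index (Var 0) (slots_uniq hb) sp.
exists (rule_annot r sg); eexists; split; [by []|exact: rule_annot_skeleton| |].
- symmetry; apply: (rule_step rG adm _ _ hp) => [B BL C Cb|B BL]; last by rewrite decE.
  have neB : slots (ann sg B) != [::] by apply/eqP => e; rewrite e in Cb.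
  have /derivable_forest_map h := tgen_derivable sk_grammar_mcftg (genB B BL neB).
  exact: pattern_vars_lt (h C Cb).
- move=> ne; rewrite hp; apply: (@tgen_rule _ _ sk_grammar (sk_rule r sg) theta').
    exact: mem_sk_rules.
  move=> X; rewrite mem_sk_links => /mapP[B]; rewrite mem_filter => /andP[neB BL] ->.
  exact: genB.
Qed.

Hypothesis root_class : forall t a, lang G t -> root_label t = Some a -> cl a = c0.

Lemma decode_leaf A c theta : decode (A, [:: Node (c, 0) [::]]) theta =
  [:: theta (slot (A, [:: Node (c, 0) [::]]) 0)].
Proof. by rewrite /decode /= vsubst_nil. Qed.

(** Soundness applies to [annot0], the only annotation containing the initial slot. For the
    converse, a reduced skeleton without variables is a single leaf; [root_class] forces its class
    to be [c0], so the annotation found is [annot0]. *)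
Lemma sk_lang : lang sk_grammar = lang G.
Proof.
apply/seteqP; split => t /=.
  move=> /(langP sk_grammar_mcftg) /sk_sound [b [theta [hb e1 e2 h]]].
  apply/(langP GM).
  have eb : annot0 = b.
    apply: (annots_inj (C := slot annot0 0) annot0_mem hb); last by rewrite -e1 inE.
    by rewrite slots0 inE.
  by move: h; rewrite -eb decode_leaf; case: e2 => ->.
move=> lt; have /(langP GM) ht := lt; apply/(langP sk_grammar_mcftg).
have [[A ss] [theta [/= eA]]] := sk_complete ht; rewrite {A}eA => hs.
have [_ _ _ [AG n0] _] := GM.
case: ss hs => [|s [|s' ss]] //= hs; rewrite /skeleton_annot /= ?andbF // andbT n0 in hs.
case/and3P: (hs) => ws /perm_nilP vs rs.
case: s vs ws rs hs => [//|[c k] us] vs; rewrite [reduced _ _]/= [vars _]/= in vs *.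
rewrite vs /= => /and3P[lc /eqP sus _] /nilP eus.
move: sus lc; rewrite {us vs}eus => <- lc hs.
rewrite decode_leaf => -[et] /(_ isT) hg.
set b : annot := (_, _) in et hg.
have hg' : tgen sk_grammar [:: slot b 0] [:: t] by rewrite -et; exact: hg.
have hb : b \in annots.
  by apply: skeleton_annot_mem => //; rewrite /skeleton_annot /= n0 hs.
(* The class [c] of the leaf is that of the root of [t], because the new grammar preserves root
   classes. *)
have eroot := fun x xG C u z => proj1 (@sk_rule_class x xG C u z).
have [|a [ra _ /eqP ca]] := tgen_root sk_grammar_mcftg same_class_equivalence eroot hg'
  (C := slot b 0) (t := t); first by rewrite /= inE eqxx.
rewrite /= (root_class lt ra) /slot_info val_slot //= in ca.
by move: hg'; rewrite /b -ca.
Qed.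

End Normalize.

Lemma mcft_root_consistent_mctal (U : choiceType) (rk : U -> nat) (L : set (tree U)) :
  MCFT rk L -> root_consistent rk L -> MC_TAL rk L.
Proof.
case=> N [G [GM <-]] rc.
suff [cl [c0 [h1 h2 h3]]] : exists (cl : U -> U) (c0 : U),
   [/\ c0 \in map cl (terms G),
       {in terms G &, forall s s', s <> s' -> cl s = cl s' -> rk s <> rk s'} &
       forall t a, lang G t -> root_label t = Some a -> cl a = c0].
  exists (slotT rk G cl c0), (sk_grammar rk G cl c0); split.
    exact: sk_grammar_mctag.
  exact: sk_lang.
pose P a := exists2 t, lang G t & root_label t = Some a.
(* If there is no root label at all, every terminal is its own class and any terminal serves as
   [c0]. *)
have [[a0 Pa0]|nP] := pselect (exists a, P a); last first.
  have [_ _ [s0 s0G _] _ _] := GM; exists id, s0; split.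
  - by rewrite map_id.
  - by move=> s s' _ _.
  - by move=> t a ht ra; case: nP; exists a, t.
have a0G : a0 \in terms G.
  have [t /(langP GM) /(tgen_derivable GM)] := Pa0.
  by rewrite /derivable_forest /= andbT => /andP[+ _]; case: t => //= a ts /andP[h _] [<-].
(* All root labels are collapsed to [a0]; root consistency says that distinct ones differ in
   rank. *)
exists (fun a => if `[< P a >] then a0 else a), a0; split.
- by apply/mapP; exists a0; rewrite // ifT //; apply/asboolP.
- move=> s s' sG s'G ne.
  case: asboolP => [[t ht rt]|nPs]; case: asboolP => [[t' ht' rt']|nPs'] //.
  + by move=> _; apply: rc ht ht' rt rt' ne.
  + by move=> e; rewrite -e in nPs'.
  + by move=> e; rewrite e in nPs.
- by move=> t a ht ra; case: asboolP => // -[]; exists t.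
Qed.

(** * Adding and erasing a root symbol *)

Section AddRoot.
Variables (N : finType) (U : choiceType) (rk : U -> nat) (G : grammar N U).
Hypothesis GM : is_mcftg rk G.
Variable hash : U.
Hypothesis rk_hash : rk hash = 1.

Definition lift_sym (a : N + U) : option N + U :=
  match a with inl C => inl (Some C) | inr s => inr s end.

Definition lift_rule (r : rule N U) : rule (option N) U :=
  Rule (map Some (lhs r)) (map (relabel lift_sym) (rhs r))
    (seq_fset tt (map (map Some) (links r))).

Definition root_rule : rule (option N) U :=
  Rule [:: None] [:: Node (inr hash) [:: Node (inl (Some (start G))) [::]]]
    (seq_fset tt [:: [:: Some (start G)]]).

Definition root_grammar : grammar (option N) U :=
  Grammar (oapp (nrk G) 0) (seq_fset tt ([:: None] :: map (map Some) (bigs G)))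
    (seq_fset tt (hash :: terms G)) None
    (seq_fset tt (root_rule :: map lift_rule (rules G))).

Let SomeI : injective (@Some N). Proof. by move=> x y []. Qed.

Lemma mem_root_bigs X :
  (X \in bigs root_grammar) = (X \in [:: None] :: map (map Some) (bigs G)).
Proof. exact: seq_fsetE. Qed.

Lemma mem_root_terms s : (s \in terms root_grammar) = (s \in hash :: terms G).
Proof. exact: seq_fsetE. Qed.

Lemma mem_root_rules r :
  (r \in rules root_grammar) = (r \in root_rule :: map lift_rule (rules G)).
Proof. exact: seq_fsetE. Qed.

Lemma mem_lift_links r X : (X \in links (lift_rule r)) = (X \in map (map Some) (links r)).
Proof. exact: seq_fsetE. Qed.

Lemma lift_pattern k t : is_pattern (sym_rk rk G) (gsym G) k t ->
  is_pattern (sym_rk rk root_grammar) (gsym root_grammar) k (relabel lift_sym t).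
Proof.
case/andP=> w p; rewrite /is_pattern vars_relabel p andbT wf_relabel.
rewrite -(eq_in_wf (rk := sym_rk rk G) (P := gsym G)) //; first by case.
move=> a ha; have Pa := allP (wf_labels w) a ha; rewrite Pa /=.
by case: a Pa {ha} => [C|s] //= sG; rewrite mem_root_terms inE sG orbT.
Qed.

Lemma nonterms_lift u :
  nonterms (map (relabel lift_sym) u) = map Some (nonterms u).
Proof.
rewrite /nonterms -map_comp (eq_map (g := map lift_sym \o @labels _)); last first.
  by move=> t /=; rewrite labels_relabel.
rewrite map_comp -map_flatten; elim: (flatten _) => //= -[C|s] l IH //=.
by rewrite IH.
Qed.

Lemma root_grammar_mcftg : is_mcftg rk root_grammar.
Proof.
case: (GM) => g1 g2 [s sG s0] [SG n0] g5; split.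
- move=> X; rewrite mem_root_bigs inE => /orP[/eqP -> //|/mapP[A AG ->]].
  have [ne u] := g1 A AG; split; first by case: (A) ne.
  by rewrite map_inj_uniq.
- move=> X X'; rewrite !mem_root_bigs !inE.
  case/orP=> [/eqP ->|/mapP[A AG ->]]; case/orP=> [/eqP ->|/mapP[A' AG' ->]] e //.
  + by have := e None; rewrite inE eqxx => /esym /mapP[].
  + by have := e None; rewrite inE eqxx => /mapP[].
  + by congr map; apply: g2 => // C; have := e (Some C); rewrite !mem_map.
- by exists s => //; rewrite mem_root_terms inE sG orbT.
- by split => //; rewrite mem_root_bigs inE eqxx.
move=> x; rewrite mem_root_rules inE => /orP[/eqP ->|/mapP[r rG ->]].
  have LE X : (X \in links root_rule) = (X == [:: Some (start G)]).
    by rewrite (seq_fsetE tt [:: [:: Some (start G)]]) inE.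
  split.
  - by rewrite mem_root_bigs inE eqxx.
  - rewrite /= /is_pattern /= rk_hash n0 /= /gsym mem_root_terms inE eqxx //.
  - by [].
  - apply/fsubsetP => X; rewrite LE => /eqP ->; rewrite mem_root_bigs inE.
    by rewrite (map_f (map Some) SG) orbT.
  split; first by move=> X X'; rewrite !LE => /eqP -> /eqP -> /eqP.
  move=> C; rewrite [nonterms _]/= inE; split => [/eqP ->|[X]].
    by exists [:: Some (start G)]; rewrite ?LE ?inE.
  by rewrite LE => /eqP ->; rewrite inE.
have [v1 /all2P[v2 v2'] v3 /fsubsetP v4 [v5 v6]] := g5 r rG; split.
- by rewrite mem_root_bigs inE (map_f (map Some) v1) orbT.
- apply/all2P; rewrite !size_map; split => // C t.
  rewrite zip_map_map => /mapP[[D u] z [-> ->]] /=; exact/lift_pattern/v2'.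
- by rewrite [rhs _]/= nonterms_lift map_inj_uniq.
- apply/fsubsetP => X; rewrite mem_lift_links mem_root_bigs => /mapP[B BL ->].
  by rewrite inE (map_f (map Some)) ?orbT //; apply: v4.
split.
  move=> X X'; rewrite !mem_lift_links => /mapP[B BL ->] /mapP[B' BL' ->] ne.
  have /(v5 B B' BL BL') /pred0P d : B != B' by apply: contraNneq ne => ->.
  apply/pred0P => -[C|] /=; first by rewrite !mem_map //; apply: d.
  by apply/negbTE/negP => /andP[/mapP[]].
move=> C; rewrite [rhs _]/= nonterms_lift; split.
  case/mapP => D /v6[B BL DB] ->; exists (map Some B); last exact: map_f.
  by rewrite mem_lift_links (map_f (map Some)).
case=> X; rewrite mem_lift_links => /mapP[B BL ->] /mapP[D DB ->].
by apply: map_f; apply/v6; exists B.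
Qed.

Lemma ev_lift (theta : option N -> tree U) t :
  ev theta (relabel lift_sym t) = ev (theta \o Some) t.
Proof.
elim/tree_ind_in: t => [i|[C|s] ts IH] //=; rewrite -map_comp.
  by congr vsubst; apply/eq_in_map.
by congr Node; apply/eq_in_map.
Qed.

Lemma tgen_lift A ts : tgen G A ts -> tgen root_grammar (map Some A) ts.
Proof.
elim=> r theta rG _ IH; pose theta' := oapp theta (Var 0).
rewrite (_ : map (ev theta) _ = map (ev theta') (rhs (lift_rule r))); last first.
  by rewrite -map_comp; apply/eq_map => t /=; rewrite ev_lift.
apply: (tgen_rule (G := root_grammar) (r := lift_rule r)).
  by rewrite mem_root_rules inE (map_f lift_rule) ?orbT.
by move=> X; rewrite mem_lift_links => /mapP[B BL ->]; rewrite -map_comp; apply: IH.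
Qed.

(** Both kinds of left-hand sides are treated in one induction, since the root rule needs the
    statement for the lifted initial nonterminal. *)
Lemma tgen_unlift X ts : tgen root_grammar X ts ->
  (forall A, X = map Some A -> tgen G A ts) /\
  (X = [:: None] -> exists2 t, tgen G [:: start G] [:: t] & ts = [:: Node hash [:: t]]).
Proof.
elim=> x theta; rewrite mem_root_rules inE => /orP[/eqP ->|/mapP[r rG ->]] _ IH.
  split; first by case.
  move=> _; exists (theta (Some (start G))); last by rewrite /= vsubst_nil.
  have [|h _] := IH [:: Some (start G)]; first by rewrite (seq_fsetE tt [:: [:: _]]) inE.
  exact: h.
split; last first.
  have [h _ _ _ _] := GM; have [_ _ _ _ /(_ r rG)[v1 _ _ _ _]] := GM.
  by move=> /=; case: (lhs r).
move=> A /= /(inj_map SomeI) <-.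
rewrite (_ : map _ _ = map (ev (theta \o Some)) (rhs r)); last first.
  by rewrite -map_comp; apply/eq_map => t /=; rewrite ev_lift.
apply: tgen_rule => // B BL; rewrite map_comp.
have [|h _] := IH (map Some B); first by rewrite mem_lift_links (map_f (map Some)).
exact: h.
Qed.

Lemma root_grammar_lang : lang root_grammar = prepend hash (lang G).
Proof.
apply/seteqP; split => t /=.
  move=> /(langP root_grammar_mcftg) /tgen_unlift[_ /(_ erefl)[u hu [->]]].
  by exists u => //; apply/(langP GM).
case=> u /(langP GM) hu <-; apply/(langP root_grammar_mcftg).
(* The root rule links only to [Some (start G)], so a valuation constant on the old nonterminals
   suffices. *)
have := @tgen_rule _ _ root_grammar root_rule (oapp (fun=> u) (Var 0)).
rewrite /= vsubst_nil; apply; first by rewrite mem_root_rules inE eqxx.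
move=> X; rewrite (seq_fsetE tt [:: [:: _]]) inE => /eqP ->.
exact: (tgen_lift hu).
Qed.

End AddRoot.

(** * Erasing a unary symbol *)

Section Erase.
Variables (S : eqType) (h : S).

(** The symbol is removed everywhere and not only at the root, so that erasing commutes with
    substitution and can be done rule by rule. Occurrences with another number of children stay,
    which avoids rank hypotheses. *)
Fixpoint erase (t : tree S) : tree S :=
  match t with
  | Var i => Var i
  | Node a ts =>
      let ts' := map erase ts in
      if a == h then (if ts' is [:: t'] then t' else Node a ts') else Node a ts'
  end.

Lemma erase_vsubst s t : erase (vsubst s t) = vsubst (map erase s) (erase t).
Proof.
elim/tree_ind_in: t => [i|a ts IH] /=; first by rewrite nthV_map.
have -> : map erase (map (vsubst s) ts) = map (vsubst (map erase s)) (map erase ts).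
  by rewrite -!map_comp; apply/eq_in_map.
by case: ifP => //; case: (map erase ts) => [|t [|t' ts']].
Qed.

Lemma vars_erase t : vars (erase t) = vars t.
Proof.
elim/tree_ind_in: t => [i|a ts IH] //=.
have <- : flatten (map (@vars S) (map erase ts)) = flatten (map (@vars S) ts).
  by rewrite -map_comp; congr flatten; apply/eq_in_map.
by case: ifP => //; case: (map erase ts) => [|t [|t' ts']] //=; rewrite cats0.
Qed.

Lemma wf_erase rk (P : pred S) t : wf rk P t -> wf rk P (erase t).
Proof.
elim/tree_ind_in: t => [i|a ts IH] //= /and3P[Pa sts /allP wts].
have w : all (wf rk P) (map erase ts).
  by rewrite all_map; apply/allP => t tts /=; apply: IH => //; apply: wts.
have: wf rk P (Node a (map erase ts)) by rewrite /= Pa size_map sts w.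
case: ifP => // _; case: (map erase ts) w => [|t [|t' ts']] //=.
by rewrite andbT.
Qed.

Lemma labels_erase (T : Type) (f : S -> option T) t : f h = None ->
  pmap f (labels (erase t)) = pmap f (labels t).
Proof.
move=> fh; elim/tree_ind_in: t => [i|a ts IH] //=.
have e : pmap f (flatten (map (@labels S) (map erase ts))) =
         pmap f (flatten (map (@labels S) ts)).
  elim: ts IH => //= t ts IHts IH; rewrite !pmap_cat IH ?inE ?eqxx // IHts // => u uts.
  by apply: IH; rewrite inE uts orbT.
rewrite -e; case: eqP => [->|_] //; rewrite fh.
by case: (map erase ts) => [|t [|t' ts']] //=; rewrite ?cats0 ?fh.
Qed.

Lemma erase_id t : h \notin labels t -> erase t = t.
Proof.
elim/tree_ind_in: t => [i|a ts IH] //=; rewrite inE negb_or eq_sym => /andP[/negbTE -> ht].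
congr Node; rewrite -[RHS]map_id; apply/eq_in_map => t tts; apply: IH => //.
by apply: contra ht => ht; apply: mem_flatten_map ht.
Qed.

End Erase.

Lemma erase_ev (N U : eqType) (h : U) (theta : N -> tree U) t :
  erase h (ev theta t) = ev (erase h \o theta) (erase (inr h) t).
Proof.
elim/tree_ind_in: t => [i|[C|s] ts IH] //=.
  rewrite erase_vsubst; congr vsubst; rewrite -!map_comp; exact/eq_in_map.
have -> : map (erase h) (map (ev theta) ts) =
   map (ev (erase h \o theta)) (map (erase (inr h)) ts).
  by rewrite -!map_comp; apply/eq_in_map.
rewrite (inj_eq (f := inr)); last by move=> ? ? [].
by case: ifP => // _; case: (map (erase (inr h)) ts) => [|t [|t' ts']].
Qed.

Section RemoveRoot.
Variables (N : finType) (U : choiceType) (rk : U -> nat) (G : grammar N U).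
Hypothesis GM : is_mcftg rk G.
Variable hash : U.

Definition erase_rule (r : rule N U) : rule N U :=
  Rule (lhs r) (map (erase (inr hash)) (rhs r)) (links r).

Definition erase_grammar : grammar N U :=
  Grammar (nrk G) (bigs G) (terms G) (start G)
    (seq_fset tt (map erase_rule (rules G))).

Lemma mem_erase_rules r :
  (r \in rules erase_grammar) = (r \in map erase_rule (rules G)).
Proof. exact: seq_fsetE. Qed.

Lemma erase_grammar_mcftg : is_mcftg rk erase_grammar.
Proof.
case: (GM) => g1 g2 g3 g4 g5; split => //.
move=> x; rewrite mem_erase_rules => /mapP[r rG ->].
have ne : nonterms (map (erase (inr hash)) (rhs r)) = nonterms (rhs r).
  rewrite /nonterms; elim: (rhs r) => //= t u IH.
  by rewrite !pmap_cat IH labels_erase.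
have [v1 /all2P[v2 v2'] v3 v4 v5] := g5 r rG; split => //=; rewrite ?ne //.
apply/all2P; rewrite size_map; split => // C t.
rewrite zip_mapr => /mapP[[D u] z [-> ->]] /=.
by have /andP[w p] := v2' _ _ z; rewrite /is_pattern vars_erase p andbT wf_erase.
Qed.

Lemma tgen_erase A ts : tgen G A ts -> tgen erase_grammar A (map (erase hash) ts).
Proof.
elim=> r theta rG _ IH.
rewrite (_ : map _ _ = map (ev (erase hash \o theta)) (rhs (erase_rule r))); last first.
  by rewrite -!map_comp; apply/eq_map => t /=; rewrite erase_ev.
apply: (tgen_rule (G := erase_grammar) (r := erase_rule r)).
  by rewrite mem_erase_rules map_f.
by move=> B BL; rewrite map_comp; apply: IH.
Qed.

Lemma tgen_unerase A ts : tgen erase_grammar A ts ->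
  exists2 us, ts = map (erase hash) us & tgen G A us.
Proof.
elim=> x theta; rewrite mem_erase_rules => /mapP[r rG ->] _ /= IH.
have [B BL|theta' ht] := @choose_theta _ _ (Var 0) (links r)
    (fun B us => map theta B = map (erase hash) us /\ tgen G B us)
    (links_disjoint GM rG) (links_uniq GM rG).
  have [us e gus] := IH B BL; exists us => //.
  exact/derivable_forest_size/(tgen_derivable GM).
exists (map (ev theta') (rhs r)).
  rewrite -!map_comp; apply/eq_in_map => t tr /=; rewrite erase_ev.
  apply: eq_in_hom => C Ct.
  (* The links belong to the original rule, but erasing a terminal leaves the nonterminals of a tree
     unchanged. *)
  have [|B BL CB] := nonterms_links GM rG (C := C).
    apply: (mem_nonterms_tree tr).
    have fN : nont (inr hash : N + U) = None by [].
    have := labels_erase t fN; move/(congr1 (fun s => C \in s)).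
    by rewrite !mem_nont Ct => <-.
  by have [] := ht B BL; rewrite -map_comp => /eq_in_map e _; apply: e.
by apply: tgen_rule => // B BL; case: (ht B BL).
Qed.

Lemma erase_grammar_lang : lang erase_grammar = [set erase hash t | t in lang G]%classic.
Proof.
apply/seteqP; split => t /=.
  move=> /(langP erase_grammar_mcftg) /tgen_unerase[[|u [|v us]] //= [->] hu].
  by exists u => //; apply/(langP GM).
by case=> u /(langP GM) /tgen_erase hu <-; apply/(langP erase_grammar_mcftg).
Qed.

End RemoveRoot.

(** * The two equalities *)

Local Open Scope classical_set_scope.

Theorem corollary59 (U : choiceType) (rk : U -> nat) :
  MC_TAL rk = [set L | MCFT rk L /\ root_consistent rk L] /\
  (forall (Sigma : {fset U}) (hash : U), hash \notin Sigma -> rk hash = 1 ->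
     forall L : set (tree U), L `<=` trees_over rk Sigma ->
       (MCFT rk L <-> MC_TAL rk (prepend hash L))).
Proof.
split.
  apply/seteqP; split => L /=; last by case; apply: mcft_root_consistent_mctal.
  case=> N [G [GT <-]]; split; last exact: mctag_root_consistent.
  by exists N, G; split => //; case: GT.
move=> Sigma hash hS rh L LS; split.
  case=> N [G [GM <-]]; apply: mcft_root_consistent_mctal.
    exists (option N), (root_grammar G hash); split; first exact: root_grammar_mcftg.
    exact: (root_grammar_lang GM rh).
  by move=> t t' a a' [u _ <-] [u' _ <-] /= [<-] [<-].
case=> N [G [[GM _ _] GL]]; exists N, (erase_grammar G hash).
split; first exact: erase_grammar_mcftg.
rewrite (erase_grammar_lang GM) GL.
(* As [hash] lies outside [Sigma], it does not occur in [u], so only the added root disappears. *)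
have eL u : L u -> erase hash (Node hash [:: u]) = u.
  move=> /LS /andP[wu _]; rewrite /= eqxx erase_id //.
  by apply: contra hS => /(allP (wf_labels wu)).
apply/seteqP; split => t /=.
  by case=> _ [u Lu <-] <-; rewrite eL.
by move=> Lt; exists (Node hash [:: t]); [exists t|exact: eL].
Qed.
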